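(* Let $G$ be a $k$-list-critical graph that is not a complete graph, and let $d(G)=\frac{2|E(G)|}{|V(G)|}$ denote its average degree. If $k \ge 7$, then \[d(G) \ge k-1 + \frac{(k-3)^2 (2 k-3)}{k^4-2 k^3-11 k^2+28 k-14}.\] If $k = 6$, then \[d(G) \ge 5 + \frac{93}{766}.\]
   Context: All graphs are finite and simple. A graph is $m$-choosable if for every assignment of a list of at least $m$ colors to each vertex there is a proper coloring in which each vertex receives a color from its list. A graph $G$ is $k$-list-critical if $G$ is not $(k-1)$-choosable, but every proper subgraph of $G$ is $(k-1)$-choosable. *)

(* Defs.v *)
From mathcomp Require Import all_boot all_order all_algebra.
From mathcomp Require Import finmap.

Set Implicit Arguments.
Unset Strict Implicit.
Unset Printing Implicit Defensive.

Import Order.TTheory GRing.Theory Num.Theory.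

(* Vertices are drawn from an ambient finite type [T], so that a graph and all
   its subgraphs (not only the spanning or induced ones) live in one type. *)
Record sgraph (T : finType) := SGraph {
  vertices : {set T};
  edges : {set {set T}};
  edges_wf : [forall e in edges, (e \subset vertices) && (#|e| == 2)]
}.

Section SimpleGraphs.
Variable T : finType.
Implicit Types G H : sgraph T.

Definition adjacent G (x y : T) : bool := [set x; y] \in edges G.

Definition subgraph H G : bool :=
  (vertices H \subset vertices G) && (edges H \subset edges G).

Definition proper_subgraph H G : bool :=
  subgraph H G && ((vertices H != vertices G) || (edges H != edges G)).

Definition complete G : bool :=
  [forall x in vertices G, forall y in vertices G, (x != y) ==> adjacent G x y].

Definition proper_coloring G (c : T -> nat) : Prop :=
  forall x y : T, adjacent G x y -> c x != c y.

(* Colors are natural numbers, which is no restriction since only finitely many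
   colors occur. The values of [L] and [c] outside [vertices G] are irrelevant. *)
Definition choosable (m : nat) G : Prop :=
  forall L : T -> {fset nat},
    (forall x, x \in vertices G -> m <= #|` L x|) ->
    exists c : T -> nat,
      proper_coloring G c /\ (forall x, x \in vertices G -> c x \in L x).

(* [k.-1] is [k - 1] only for [0 < k]. *)
Definition list_critical (k : nat) G : Prop :=
  ~ choosable k.-1 G /\
  (forall H, proper_subgraph H G -> choosable k.-1 H).

Definition average_degree G : rat :=
  ((2 * #|edges G|)%:R / #|vertices G|%:R)%R.

End SimpleGraphs.

(* Main.v *)
(** Color [G - F] from a bad list assignment: the colors left on [F] do not
    suffice to color [F], although every [v] in [F] keeps at least
    [deg_F v + (k - 1) - deg_G v] of them. So on "low" vertices (degree [k - 1])
    the lists are at least as long as the degree in [F], and on "mid" vertices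
    (degree [k]) they are at most one shorter. This has two consequences.

    First, an induced subgraph of low vertices that is connected and has no cut
    vertex is complete or 2-regular (Gallai). Removing end blocks one at a time
    bounds from below the number of edges that leave the low vertices, where an
    edge leaving a copy of [K_{k-1}] counts [1 + h] times and each "cluster" (a
    component of the union of these copies) costs [h], or [3 * h] if it is a
    whole component of the low graph.

    Second, in an uncolorable cluster the colors missing at one vertex determine
    those missing at all others. So if each cluster picks an adjacent mid vertex
    [y], coloring the mid vertices greedily has to avoid just one color at [y]
    for each cluster that picked [y], and this succeeds when [y] keeps two edges
    to clusters that are not used by picks. By Hall's theorem such picks exist in
    some subconfiguration as soon as there are more than two edges per mid vertex
    plus one (or three) per cluster. Hence there are not that many edges.

    Together these give an average degree of at least
    [k - 1 + (2k-5)(k-3) / (k^3-12k+15)], which exceeds both bounds. *)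
Require Import Defs.
From mathcomp Require Import all_boot all_order all_algebra.
From mathcomp Require Import finmap zify ring lra.
From Stdlib Require Import Classical.

Set Implicit Arguments.
Unset Strict Implicit.
Unset Printing Implicit Defensive.

Import Order.TTheory GRing.Theory Num.Theory.

(** * Hall's marriage theorem *)

(** Induction on the total size of the sets. If some [r a] has two elements, one of them can be
    deleted without violating Hall's condition; once all sets are singletons, the condition for
    pairs makes the choice injective. *)
Lemma hall (A B : finType) (r : A -> {set B}) :
  (forall X : {set A}, #|X| <= #|\bigcup_(a in X) r a|) ->
  exists2 f : A -> B, injective f & forall a, f a \in r a.
Proof.
have [n] := ubnP (\sum_a #|r a|); elim: n r => // n IHn r ltn hallr.
have ne a : 0 < #|r a| by have := hallr [set a]; rewrite cards1 big_set1.
have [/existsP[a lt1a]|] := boolP [exists a, 1 < #|r a|]; last first.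
  rewrite negb_exists => /forallP le1.
  have s1 a : exists b, r a == [set b].
    have /cards1P[b ->]: #|r a| == 1 by rewrite eqn_leq ne leqNgt le1.
    by exists b.
  exists (fun a => xchoose (s1 a)); last first.
    by move=> a; rewrite {2}(eqP (xchooseP (s1 a))) set11.
  move=> a a' eqf; apply: contraTeq (hallr [set a; a']) => neq.
  rewrite cards2 neq bigcup_setU !big_set1.
  by rewrite (eqP (xchooseP (s1 a))) (eqP (xchooseP (s1 a'))) eqf setUid cards1.
have [x [y [xr yr neq]]] : exists x y, [/\ x \in r a, y \in r a & x != y].
  by have /card_gt1P[x [y [xr yr neq]]] := lt1a; exists x, y.
pose rm z a' := if a' == a then r a :\ z else r a'.
have step z : z \in r a -> (forall X : {set A}, #|X| <= #|\bigcup_(b in X) rm z b|) ->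
    exists2 f : A -> B, injective f & forall b, f b \in r b.
  move=> zr hz; case: (IHn (rm z)) => // [|f finj fr].
    rewrite -ltnS; apply: leq_trans ltn; rewrite ltnS.
    rewrite (bigD1 a) //= [X in _ < X](bigD1 a) //= /rm eqxx.
    rewrite (cardsD1 z (r a)) zr /= add1n addSn ltnS leq_add2l.
    by rewrite leq_eqVlt; apply/orP; left; apply/eqP/eq_bigr => b /negPf->.
  exists f => // b; have := fr b; rewrite /rm.
  by case: eqP => // ->; rewrite in_setD1 => /andP[].
have [/forallP hx|] := boolP [forall X : {set A}, #|X| <= #|\bigcup_(b in X) rm x b|].
  exact: (step x).
have [/forallP hy _|] := boolP [forall X : {set A}, #|X| <= #|\bigcup_(b in X) rm y b|].
  exact: (step y).
(* Both deletions fail, with violators [X] and [Y], which must contain [a]. Since [x != y], the two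
   reduced unions together still cover [r a], so by submodularity Hall's condition fails for the
   union of [X] and [Y] or for their intersection without [a]. *)
rewrite !negb_forall => /existsP[Y]; rewrite -ltnNge => ltY /existsP[X].
rewrite -ltnNge => ltX.
have rmE z (Z : {set A}) : #|\bigcup_(b in Z) rm z b| < #|Z| ->
    a \in Z /\ \bigcup_(b in Z) rm z b = (\bigcup_(b in Z :\ a) r b) :|: (r a :\ z).
  move=> ltZ; have aZ : a \in Z.
    apply: contraTT ltZ => aZ; rewrite -leqNgt.
    rewrite (eq_bigr r) ?hallr // => b bZ; rewrite /rm.
    by case: eqP => // eqb; rewrite -eqb bZ in aZ.
  split=> //; rewrite (big_setD1 a) //= /rm eqxx setUC; congr (_ :|: _).
  by apply: eq_bigr => b /setD1P[/negPf->].
have [aX eX] := rmE _ _ ltX; have [aY eY] := rmE _ _ ltY.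
rewrite eX (cardsD1 a X) aX add1n ltnS in ltX.
rewrite eY (cardsD1 a Y) aY add1n ltnS in ltY.
set X' := X :\ a in ltX *; set Y' := Y :\ a in ltY *.
set UX := _ :|: _ in ltX; set UY := _ :|: _ in ltY.
have subU : \bigcup_(b in a |: (X' :|: Y')) r b \subset UX :|: UY.
  apply/bigcupsP => b; rewrite in_setU1 in_setU => /orP[/eqP->|/orP[bX|bY]].
  - apply/subsetP => z zr; rewrite /UX /UY !in_setU !in_setD1 zr !andbT.
    by have [->|] := eqVneq z x; rewrite ?neq ?orbT.
  - by apply/subsetU/orP; left; rewrite /UX subsetU // bigcup_sup.
  - by apply/subsetU/orP; right; rewrite /UY subsetU // bigcup_sup.
have subI : \bigcup_(b in X' :&: Y') r b \subset UX :&: UY.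
  apply/bigcupsP => b /setIP[bX bY]; rewrite subsetI /UX /UY.
  by rewrite !subsetU ?bigcup_sup.
have := leq_trans (hallr _) (subset_leq_card subU).
have := leq_trans (hallr _) (subset_leq_card subI).
rewrite cardsU1 !in_setU /X' /Y' !setD11 /= add1n -/X' -/Y'.
have := cardsUI UX UY; have := cardsUI X' Y'.
by move: ltX ltY; lia.
Qed.

(** * Orienting the edges of a multigraph under in-degree demands *)

Section Orientation.

Variables (E V : finType) (s t : E -> V) (n : V -> nat).

Let inside (X : {set V}) := [set x | (s x \in X) && (t x \in X)].

(** Take [X] minimal among the vertex sets with more inside edges than total demand. Then each
    nonempty part of [X] meets more of these edges than it demands, which is Hall's condition for
    matching demands to edges. *)
Lemma orientation :
  \sum_v n v < #|E| ->
  exists2 X : {set V}, 0 < #|inside X| &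
  exists g : {ffun E -> V},
    (forall x, g x = s x \/ g x = t x) /\
    forall v, v \in X -> n v <= #|[set x in inside X | g x == v]|.
Proof.
move=> big.
have ex0 : exists X : {set V}, \sum_(v in X) n v < #|inside X|.
  exists setT; rewrite (eq_bigl xpredT) => [|v]; last by rewrite in_setT.
  by apply: leq_trans big _; apply/subset_leq_card/subsetP => x _; rewrite !inE.
have [X ltX minX] := arg_minnP (fun X : {set V} => #|X|) (xchooseP ex0).
exists X; first exact: leq_ltn_trans ltX.
have minD (X0 : {set V}) : X0 \subset X -> X0 != set0 ->
    \sum_(v in X0) n v < #|inside X :\: inside (X :\: X0)|.
  move=> sX0 X0n0.
  have subI : inside (X :\: X0) \subset inside X.
    by apply/subsetP => x; rewrite !inE -!andbA => /and4P[_ -> _ ->].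
  have leI : #|inside (X :\: X0)| <= \sum_(v in X :\: X0) n v.
    rewrite leqNgt; apply: contra X0n0 => /minX; rewrite cardsD (setIidPr sX0).
    by have := subset_leq_card sX0; rewrite -cards_eq0; lia.
  have := cardsD (inside X) (inside (X :\: X0)); rewrite (setIidPr subI).
  have := subset_leq_card subI.
  move: ltX; rewrite (big_setID X0) /= (setIidPr sX0); lia.
(* [C] contains [n v] copies of each [v] in [X], each to be matched to its own edge at [v] inside
   [X]. *)
pose C : finType := {c : {v : V & 'I_(n v)} | tag c \in X}.
pose r (c : C) := [set x in inside X | (s x == tag (val c)) || (t x == tag (val c))].
have [|f finj fr] := @hall C E r.
  move=> Z; have [->|Zn0] := eqVneq Z set0; first by rewrite cards0.
  pose X0 := [set tag (val c) | c in Z].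
  have sX0 : X0 \subset X by apply/subsetP=> _ /imsetP[[c cX] _ ->].
  have X0n0 : X0 != set0.
    have /set0Pn[c cZ] := Zn0; apply/set0Pn; exists (tag (val c)).
    exact: imset_f.
  apply: leq_trans (leq_trans (ltnW (minD _ sX0 X0n0)) _).
    rewrite -(card_imset _ val_inj) -sum1_card.
    apply: (@leq_trans (\sum_(c : {v : V & 'I_(n v)} | tag c \in X0) 1)).
      rewrite sum1_card [X in _ <= X]sum1_card.
      apply/subset_leq_card/subsetP => _ /imsetP[c cZ ->].
      by rewrite -topredE /=; apply/imsetP; exists c.
    rewrite (eq_bigl (fun c => (tag c \in X0) && true)) => [|c]; last by rewrite andbT.
    rewrite -(sig_big_dep (fun v => v \in X0) (fun _ _ => true) (fun _ _ => 1)) /=.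
    by apply: leq_sum => v _; rewrite sum1_card card_ord.
  apply/subset_leq_card/subsetP => x; rewrite !inE negb_and !negb_and !negbK.
  move=> /andP[h /andP[sx tx]]; move: h; rewrite sx tx !orbF.
  by case/orP=> /imsetP[c cZ eqc]; apply/bigcupP; exists c => //;
    rewrite !inE sx tx eqc eqxx ?orbT.
(* An edge matched to no copy may go to either end; by default it goes to [t]. *)
pose hit x v := [exists c : C, (f c == x) && (tag (val c) == v)].
exists [ffun x => if hit x (s x) then s x else t x].
split=> [x|v vX]; first by rewrite ffunE; case: ifP; [left|right].
pose c i : C := exist _ (Tagged (fun v => 'I_(n v)) i : {v : V & 'I_(n v)}) vX.
have cinj : injective (fun i => f (c i)).
  by move=> i j /finj/(congr1 val)/= /eqP; rewrite -tag_eqE /tag_eq eqxx /=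
     tagged_asE => /eqP.
rewrite -[X in X <= _]card_ord -(card_imset _ cinj).
apply/subset_leq_card/subsetP => _ /imsetP[i _ ->]; rewrite !inE ffunE.
have := fr (c i); rewrite !inE /= => /andP[-> eqv] /=.
have [/existsP[c' /andP[/eqP/finj-> /eqP/= <-]]//|nh] := boolP (hit _ _).
have: hit (f (c i)) v by apply/existsP; exists (c i); rewrite /= !eqxx.
by case/orP: eqv nh => /eqP-> // /negP.
Qed.

End Orientation.

(** * Degrees, connectivity, end blocks and list colorings on vertex sets *)

Section Basics.

Variables (T : finType) (e : rel T).
Implicit Types (A B C D Q S : {set T}) (x y z v : T) (L : T -> {fset nat}).

Definition degin S v := #|[set u in S | e v u]|.

(** That is, [A] is a union of components of the graph induced on [S]. *)
Definition closed_in A S :=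
  (A \subset S) && [forall x in A, forall y in S, e x y ==> (y \in A)].

Definition conn S :=
  [forall A : {set T}, (A != set0) && closed_in A S ==> (A == S)].

Definition clique S := [forall x in S, forall y in S, (x != y) ==> e x y].

Definition proper_on S (c : T -> nat) :=
  {in S &, forall x y, e x y -> c x != c y}.

Definition colorable S L :=
  exists2 c : T -> nat, proper_on S c & {in S, forall x, c x \in L x}.

Lemma closed_inP A S :
  reflect (A \subset S /\ forall x y, x \in A -> y \in S -> e x y -> y \in A)
    (closed_in A S).
Proof.
apply: (iffP andP) => -[sAS H]; split=> //.
  by move=> x y xA yS exy; move/forall_inP/(_ x xA)/forall_inP/(_ y yS)/implyP: H; apply.
by apply/forall_inP=> x xA; apply/forall_inP=> y yS; apply/implyP; apply: H.
Qed.

Lemma connP S :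
  reflect (forall A, A != set0 -> closed_in A S -> A = S) (conn S).
Proof.
apply: (iffP forallP) => H A; last by apply/implyP => /andP[? ?]; apply/eqP/H.
by move=> A0 cA; apply/eqP; move/implyP: (H A); rewrite A0 cA; apply.
Qed.

Lemma conn_exit S A : conn S -> A \subset S -> A != set0 -> A != S ->
  exists x y, [/\ x \in A, y \in S, y \notin A & e x y].
Proof.
move=> /connP cS sAS A0 /eqP AS.
have [/exists_inP[x xA /exists_inP[y /setDP[yS yA] exy]]|noex] :=
  boolP [exists x in A, exists y in S :\: A, e x y]; first by exists x, y.
case: AS; apply: cS => //; apply/closed_inP; split=> // x y xA yS exy.
apply: contraNT noex => yA; apply/exists_inP; exists x => //.
by apply/exists_inP; exists y; rewrite // inE yA.
Qed.

Lemma cliqueP S : reflect {in S &, forall x y, x != y -> e x y} (clique S).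
Proof.
apply: (iffP forall_inP) => H x.
  by move=> y xS yS; move/forall_inP/(_ y yS)/implyP: (H x xS); apply.
by move=> xS; apply/forall_inP => y yS; apply/implyP; apply: H.
Qed.

Lemma degin_sub A S v : A \subset S -> degin A v <= degin S v.
Proof.
move=> /subsetP sAS; apply/subset_leq_card/subsetP => u; rewrite !inE.
by move=> /andP[/sAS-> ->].
Qed.

Lemma degin_disj A B v : [disjoint A & B] ->
  degin (A :|: B) v = degin A v + degin B v.
Proof.
move=> dAB; have -> : degin (A :|: B) v = #|[set u in A | e v u] :|: [set u in B | e v u]|.
  by congr #|pred_of_set _|; apply/setP=> u; rewrite !inE andb_orl.
rewrite cardsU; have -> : [set u in A | e v u] :&: [set u in B | e v u] = set0.
  apply/setP=> u; rewrite !inE; apply/negP => /andP[/andP[uA _] /andP[uB _]].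
  by move/pred0P/(_ u): dAB; rewrite /= uA uB.
by rewrite cards0 subn0.
Qed.

Lemma degin_setID A S v : A \subset S -> degin S v = degin A v + degin (S :\: A) v.
Proof.
move=> sAS; rewrite -degin_disj; last by apply/pred0P=> u; rewrite /= !inE; case: (u \in A).
by congr degin; rewrite -{1}(setID S A) (setIidPr sAS).
Qed.

Lemma degin_gt0 S v u : u \in S -> e v u -> 0 < degin S v.
Proof. by move=> uS evu; apply/card_gt0P; exists u; rewrite inE uS. Qed.

Lemma degin_eq0 S v : (forall u, u \in S -> ~~ e v u) -> degin S v = 0.
Proof.
move=> H; apply/eqP; rewrite cards_eq0; apply/eqP/setP=> u; rewrite !inE.
by case uS: (u \in S) => //=; apply/negbTE/H.
Qed.

Lemma degin1 v u : degin [set u] v = e v u.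
Proof.
rewrite /degin; case evu: (e v u).
  by rewrite (_ : [set _ in _ | _] = [set u]) ?cards1 //; apply/setP=> w; rewrite !inE;
     case: eqP => // ->.
by apply/eqP; rewrite cards_eq0; apply/eqP/setP=> w; rewrite !inE; case: eqP => // ->.
Qed.

Lemma degin_D1 S v u : u \in S -> degin S v = e v u + degin (S :\ u) v.
Proof. by move=> uS; rewrite (@degin_setID [set u]) ?sub1set // degin1. Qed.

Lemma degin_le_card S v : degin S v <= #|S|.
Proof. by apply/subset_leq_card/subsetP=> u; rewrite inE => /andP[]. Qed.

Lemma degin_exit A S v u : A \subset S -> u \in S -> u \notin A -> e v u ->
  degin A v < degin S v.
Proof.
move=> sAS uS uA evu; rewrite (degin_setID v sAS) -[X in X < _]addn0 ltn_add2l.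
by apply: degin_gt0 evu; rewrite inE uA.
Qed.

Hypotheses (e_sym : symmetric e) (e_irr : irreflexive e).

Lemma closed_inD A S : closed_in A S -> closed_in (S :\: A) S.
Proof.
move=> /closed_inP[sAS H]; apply/closed_inP; split=> [|x y]; first exact: subsetDl.
rewrite !inE => /andP[xA xS] yS exy; rewrite yS andbT; apply: contra xA => yA.
by apply: H yA xS _; rewrite e_sym.
Qed.

(** [C] is a smallest closed set inside [A] that contains [x]. Of a closed part of [C] and its
    complement in [C], one contains [x], and by minimality it is all of [C]. *)
Lemma component A S x : closed_in A S -> x \in A ->
  exists C, [/\ closed_in C S, C \subset A, x \in C & conn C].
Proof.
move=> cA xA; pose P C := [&& closed_in C S, C \subset A & x \in C].
have PA : P A by rewrite /P cA subxx.
have [C /and3P[cC sCA xC] minC] := arg_minnP (fun C => #|C|) PA.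
exists C; split=> //; apply/connP => B B0 cB.
have [sCS HC] := closed_inP _ _ cC.
have trans D : closed_in D C -> closed_in D S.
  move=> /closed_inP[sDC HD]; apply/closed_inP; split; first exact: subset_trans sCS.
  by move=> u v uD vS euv; apply: HD (euv) => //; apply: HC euv => //; apply: (subsetP sDC).
have [sBC _] := closed_inP _ _ cB.
have min D : closed_in D C -> x \in D -> D = C.
  move=> cD xD; have [sDC _] := closed_inP _ _ cD.
  by apply/eqP; rewrite eqEcard sDC minC // /P trans // (subset_trans sDC).
have [xB|xB] := boolP (x \in B); first exact: min.
have := min _ (closed_inD cB); rewrite inE xB xC => /(_ isT) /setP eqC.
have /set0Pn[y yB] := B0; have := eqC y; rewrite inE yB /=.
by rewrite (subsetP sBC _ yB).
Qed.

(** Greedy coloring along a degeneracy order: [v] comes last, when its neighbors use fewer colors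
    than its list has. *)
Lemma degenerate_colorable S L :
  (forall A, A \subset S -> A != set0 -> exists2 v, v \in A & degin A v < #|` L v|) ->
  colorable S L.
Proof.
have [n] := ubnP #|S|; elim: n S => // n IHn S ltS H.
have [->|S0] := eqVneq S set0; first by exists (fun=> 0) => x; [move=> y|]; rewrite inE.
have [v vS ltv] := H S (subxx _) S0.
have [|A sA A0|c pc cL] := IHn (S :\ v).
- by rewrite -ltnS; apply: leq_trans ltS; rewrite ltnS [X in _ < X](cardsD1 v) vS.
- by apply: H A0; apply: subset_trans sA (subsetDl _ _).
pose used := [fset c u | u in [set u in S | e v u]]%fset.
have /fset0Pn[a] : (L v `\` used != fset0)%fset.
  rewrite -cardfs_gt0 cardfsD subn_gt0; apply: leq_ltn_trans ltv.
  apply: leq_trans (fsubset_leq_card (fsubsetIr _ _)) _.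
  by apply: leq_trans (leq_imfset_card _ _ _) _; rewrite -cardE.
rewrite inE => /andP[aused aL].
have nb u : u \in S -> e v u -> a != c u.
  move=> uS evu; apply: contraNneq aused => ->.
  by apply/imfsetP; exists u => //=; rewrite inE uS.
exists (fun x => if x == v then a else c x) => [x y xS yS|x xS]; last first.
  by have [->|xv] := eqVneq x v; rewrite // cL // !inE xv.
have [->|xv] := eqVneq x v; have [->|yv] := eqVneq y v => exy.
- by rewrite e_irr in exy.
- exact: nb.
- by rewrite eq_sym nb // e_sym.
- by apply: pc; rewrite // !inE ?xv ?yv.
Qed.

(** By connectivity, any nonempty part of [S] without [v] has a vertex with a neighbor in [S]
    outside the part, so [S] can be colored greedily toward [v]. *)
Lemma conn_surplus_colorable S L v : conn S ->
  {in S, forall u, degin S u <= #|` L u|} -> v \in S -> degin S v < #|` L v| ->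
  colorable S L.
Proof.
move=> cS Ld vS ltv; apply: degenerate_colorable => A sA A0.
have [vA|vA] := boolP (v \in A).
  by exists v => //; apply: leq_ltn_trans ltv; apply: degin_sub.
have [|x [y [xA yS yA exy]]] := conn_exit cS sA A0.
  by apply: contraNneq vA => ->.
exists x => //; apply: leq_trans (Ld _ (subsetP sA _ xA)).
exact: degin_exit exy.
Qed.

Definition avail Q (c : T -> nat) L v : {fset nat} :=
  [fset a in L v | [forall u in Q, e v u ==> (c u != a)]]%fset.

Lemma availP Q c L v a :
  reflect (a \in L v /\ forall u, u \in Q -> e v u -> c u != a) (a \in avail Q c L v).
Proof.
rewrite !inE; apply: (iffP andP) => -[aL H]; split=> //.
  by move=> u uQ evu; move/forall_inP/(_ u uQ)/implyP: H; apply.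
by apply/forall_inP => u uQ; apply/implyP; apply: H.
Qed.

Lemma card_avail Q c L v : #|` L v| <= #|` avail Q c L v| + degin Q v.
Proof.
pose used := [fset c u | u in [set u in Q | e v u]]%fset.
have sub : (L v `\` used `<=` avail Q c L v)%fset.
  apply/fsubsetP => a; rewrite inE => /andP[aused aL]; apply/availP; split=> // u uQ evu.
  apply: contraNneq aused => <-; apply/imfsetP; exists u => //=.
  by rewrite inE uQ.
have le : #|` used| <= degin Q v.
  by apply: leq_trans (leq_imfset_card _ _ _) _; rewrite -cardE.
have := fsubset_leq_card sub; rewrite cardfsD.
have := fsubset_leq_card (fsubsetIr (L v) used); move: le; lia.
Qed.

(** A neighbor with a color outside [L v] takes nothing from [v], which saves one color over
    [card_avail]. *)
Lemma card_avail_missed Q c L v u :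
  u \in Q -> e v u -> c u \notin L v -> #|` L v| < #|` avail Q c L v| + degin Q v.
Proof.
move=> uQ evu cuL; rewrite (degin_D1 _ uQ) evu addnCA add1n ltnS.
have -> : avail Q c L v = avail (Q :\ u) c L v; last exact: card_avail.
apply/fsetP=> a; apply/availP/availP => -[aL H]; split=> // w.
  by rewrite inE => /andP[_ wQ]; apply: H.
move=> wQ evw; have [->|wu] := eqVneq w u; first by apply: contraNneq cuL => ->.
by apply: H; rewrite // !inE wu.
Qed.

Lemma colorable_extend Q S c L : Q \subset S ->
  proper_on Q c -> {in Q, forall x, c x \in L x} ->
  colorable (S :\: Q) (avail Q c L) -> colorable S L.
Proof.
move=> sQS pc cL [d pd dL].
have dP x : x \in S -> x \notin Q -> d x \in L x /\ forall u, u \in Q -> e x u -> c u != d x.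
  by move=> xS xQ; apply/availP/dL; rewrite inE xQ.
exists (fun x => if x \in Q then c x else d x) => [x y xS yS exy|x xS].
  case: ifPn => xQ; case: ifPn => yQ.
  - exact: pc.
  - by have [_] := dP y yS yQ; apply; rewrite // e_sym.
  - by rewrite eq_sym; have [_] := dP x xS xQ; apply.
  - by apply: pd; rewrite // !inE ?xQ ?yQ.
by case: ifPn => xQ; [apply: cL | have [] := dP x xS xQ].
Qed.

Lemma degin_clique S v : clique S -> v \in S -> degin S v = #|S|.-1.
Proof.
move=> /cliqueP cS vS; rewrite (cardsD1 v S) vS /=; congr #|pred_of_set _|.
apply/setP=> u; rewrite !inE andbC; have [->|uv] := eqVneq u v; first by rewrite e_irr.
by case uS: (u \in S) => //; [rewrite cS // eq_sym | rewrite andbF].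
Qed.

Lemma clique_full S : {in S, forall v, degin S v = #|S|.-1} -> clique S.
Proof.
move=> H; apply/cliqueP => x y xS yS; apply: contraNT => exy.
have := H x xS; rewrite /degin => /eqP; apply: contraTT => xy.
rewrite neq_ltn; apply/orP; left; rewrite (cardsD1 x S) xS /= add0n.
apply: proper_card; apply/properP; split.
  apply/subsetP => u; rewrite !inE => /andP[uS exu]; rewrite uS andbT.
  by apply: contraTneq exu => ->; rewrite e_irr.
by exists y; rewrite !inE ?yS ?(negPf exy) // eq_sym xy.
Qed.

Lemma clique_conn S : clique S -> conn S.
Proof.
move=> /cliqueP cS; apply/connP => A /set0Pn[x xA] /closed_inP[sAS HA].
apply/eqP; rewrite eqEsubset sAS /=; apply/subsetP => y yS.
have [->//|yx] := eqVneq y x.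
by apply: (HA _ _ xA yS); apply: cS => //; [exact: (subsetP sAS _ xA)|rewrite eq_sym].
Qed.

Lemma conn_clique_sub A S C : clique C -> C \subset S -> closed_in A S ->
  A :&: C != set0 -> C \subset A.
Proof.
move=> /cliqueP cC /subsetP sCS /closed_inP[_ HA] /set0Pn[x /setIP[xA xC]].
apply/subsetP => y yC; have [->//|yx] := eqVneq y x.
by apply: (HA _ _ xA (sCS _ yC)); apply: cC => //; rewrite eq_sym.
Qed.

Lemma conn_add C y w : conn C -> w \in C -> e y w -> conn (y |: C).
Proof.
move=> cC wC eyw; apply/connP => D D0 /closed_inP[sD HD].
have clD : D :&: C != set0 -> C \subset D.
  move=> DC0; apply/setIidPl; rewrite setIC.
  move/connP: cC; apply=> //; apply/closed_inP; split; first exact: subsetIr.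
  move=> u v /setIP[uD uC] vC euv; rewrite inE vC andbT.
  by apply: HD uD _ euv; rewrite !inE vC orbT.
have sCD : C \subset D.
  have [DC0|/clD//] := eqVneq (D :&: C) set0.
  have /set0Pn[u uD] := D0; have := subsetP sD u uD; rewrite !inE.
  case/orP=> [/eqP uy|uC]; last by move/setP/(_ u): DC0; rewrite !inE uD uC.
  apply: clD; apply/set0Pn; exists w; rewrite inE wC andbT.
  by apply: HD uD _ _; rewrite ?uy // !inE wC orbT.
apply/eqP; rewrite eqEsubset sD subUset sCD andbT sub1set.
by apply: HD (subsetP sCD _ wC) _ _; rewrite ?inE ?eqxx // e_sym.
Qed.

(** Single vertices and single edges qualify, because [conn] holds for the empty set. *)
Definition nocut B := conn B && [forall y in B, conn (B :\ y)].

(* Only [x] may have neighbors in [S] outside [B]. *)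
Definition hangs B x S :=
  [&& B \subset S, x \in B & closed_in (B :\ x) (S :\ x)].

Lemma hangs_degin B x S v : hangs B x S -> v \in B :\ x -> degin S v = degin B v.
Proof.
move=> /and3P[sBS xB /closed_inP[sBx HB]] vBx.
rewrite (degin_setID v sBS) [X in _ + X]degin_eq0 ?addn0 // => u /setDP[uS uB].
apply: contra uB => evu; have [->//|ux] := eqVneq u x.
suff: u \in B :\ x by case/setD1P.
by apply: HB vBx _ evu; rewrite !inE ux.
Qed.

(** A smallest connected hanging set works: if [y] were a cut vertex, a component of [B :\ y] that
    avoids [x], together with [y], would hang at [y] and be smaller. The last conclusion keeps the
    non-root vertices of the block away from [x0]. *)
Lemma end_block S B0 x0 : conn B0 -> 1 < #|B0| -> hangs B0 x0 S ->
  exists B x, [/\ hangs B x S, nocut B, 1 < #|B|, B \subset B0 & B :\ x \subset B0 :\ x0].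
Proof.
move=> cB0 gt1 h0.
pose P (p : {set T} * T) := [&& conn p.1, 1 < #|p.1|, hangs p.1 p.2 S, p.1 \subset B0
  & p.1 :\ p.2 \subset B0 :\ x0].
have P0 : P (B0, x0) by rewrite /P /= cB0 gt1 h0 !subxx.
have [[B x] /and5P[/= cB gtB hB sB sBx] minB] := arg_minnP (fun p : {set T} * T => #|p.1|) P0.
exists B, x; split=> //; apply/andP; split=> //; apply/forall_inP => y yB.
have [sBS xB /closed_inP[sBxS HB]] := and3P hB.
apply/negPn/negP => /forallPn[A]; rewrite negb_imply -andbA => /and3P[A0 cA neqA].
have [sAB HA] := closed_inP _ _ cA.
have [C [kC C0 sC xC]] : exists C,
    [/\ conn C, C != set0, closed_in C (B :\ y) & C != B :\ y /\ x \notin C].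
  have [A1 [A10 cA1 xA1]] : exists A1,
      [/\ A1 != set0, closed_in A1 (B :\ y) & A1 != B :\ y /\ x \notin A1].
    have [xA|xA] := boolP (x \in A); last by exists A.
    exists ((B :\ y) :\: A); rewrite closed_inD // inE xA; split=> //.
      by apply: contra neqA; rewrite setD_eq0 eqEsubset sAB => ->.
    split=> //; apply: contra A0 => /eqP/setP/(_ x).
    by rewrite inE xA /= => /esym; rewrite (subsetP sAB _ xA).
  have /set0Pn[z zA1] := A10; have [C [cC sCA zC kC]] := component cA1 zA1.
  exists C; split=> //; first by apply/set0Pn; exists z.
  case: xA1 => neq xA1; split; last by apply: contra xA1; apply: (subsetP sCA).
  have [sA1 _] := closed_inP _ _ cA1.
  by apply: contra neq => /eqP eqC; rewrite eqEsubset sA1 -eqC.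
case: xC => neqC xC; have [sCB HC] := closed_inP _ _ sC.
have yC : y \notin C by apply/negP => /(subsetP sCB); rewrite !inE eqxx.
have sCB' : C \subset B by apply: subset_trans sCB (subsetDl _ _).
have [w [wC eyw]] : exists w, w \in C /\ e y w.
  have [|u [w [uC wB wC euw]]] := conn_exit cB sCB' C0.
    by apply: contraNneq yC => ->.
  exists u; split=> //; rewrite e_sym; suff -> : y = w by [].
  apply/eqP; apply: contraNT wC => yw; apply: HC uC _ euw.
  by rewrite !inE wB eq_sym yw.
have : P (y |: C, y).
  apply/and5P; split=> /=.
  - exact: conn_add kC wC eyw.
  - by rewrite cardsU1 yC add1n ltnS card_gt0.
  - rewrite /hangs !inE eqxx /= subUset sub1set (subsetP sBS _ yB) (subset_trans sCB' sBS) /=.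
    rewrite setU1K //; apply/closed_inP; split.
      apply/subsetP => u uC; rewrite !inE (subsetP sBS) ?(subsetP sCB') // andbT.
      by apply: contraNneq yC => <-.
    move=> u v uC; rewrite !inE => /andP[vy vS] euv.
    apply: (HC _ _ uC _ euv); rewrite !inE vy /=.
    have [->//|vx] := eqVneq v x.
    suff: v \in B :\ x by rewrite !inE => /andP[].
    apply: HB (euv); rewrite !inE ?vx ?vS // (subsetP sCB') // andbT.
    by apply: contraNneq xC => <-.
  - by rewrite subUset sub1set (subsetP sB _ yB) (subset_trans sCB').
  - rewrite setU1K //; apply: subset_trans sBx; apply/subsetP => u uC.
    by rewrite !inE (subsetP sCB') // andbT; apply: contraNneq xC => <-.
move=> /minB /=; apply/negP; rewrite -ltnNge cardsU1 yC (cardsD1 y B) yB !add1n ltnS.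
by apply: proper_card; rewrite properEneq neqC.
Qed.

End Basics.

(** * Gallai's theorem for blocks of low vertices *)

Section Blocks.

Variables (T : finType) (e : rel T).
Hypotheses (e_sym : symmetric e) (e_irr : irreflexive e).
Implicit Types (A B C D Q S : {set T}) (x y z v : T) (L : T -> {fset nat}).

Definition deg_lists S L := {in S, forall v, degin e S v <= #|` L v|}.

Lemma tight_lists S L : conn e S -> deg_lists S L -> ~ colorable e S L ->
  {in S, forall v, #|` L v| = degin e S v}.
Proof.
move=> cS Ld nc v vS; apply/eqP; rewrite eqn_leq Ld // andbT leqNgt.
by apply/negP => ltv; apply: nc; apply: conn_surplus_colorable ltv.
Qed.

(** If a color [a] of [L u] were missing in [L v], give it to [u]. The other vertices lose at most
    as many colors as neighbors, and [v] loses a neighbor but no color, so the connected rest has a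
    surplus at [v] and can be colored. *)
Lemma noncut_sublist S L u v : conn e (S :\ u) -> u \in S -> v \in S -> e u v ->
  deg_lists S L -> ~ colorable e S L -> (L u `<=` L v)%fset.
Proof.
move=> cS uS vS euv Ld nc; apply/fsubsetP => a aLu; apply/negPn/negP => aLv.
apply: nc; apply: (@colorable_extend _ _ e_sym [set u] _ (fun=> a)).
- by rewrite sub1set.
- by move=> x y /set1P-> /set1P->; rewrite e_irr.
- by move=> x /set1P->.
have vu : v != u by apply: contraTneq euv => ->; rewrite e_irr.
have evu : e v u by rewrite e_sym.
apply: (@conn_surplus_colorable _ _ e_sym e_irr _ _ v cS).
- move=> x /setD1P[xu xS]; have := card_avail e [set u] (fun=> a) L x.
  by have := Ld x xS; rewrite (degin_D1 e x uS) degin1; clear; lia.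
- by rewrite !inE vu.
have := @card_avail_missed _ e [set u] (fun=> a) L v u (set11 u) evu aLv.
by have := Ld v vS; rewrite (degin_D1 e v uS) degin1; clear; lia.
Qed.

Variable Low : {set T}.
Hypothesis low_bad : forall B, B \subset Low -> B != set0 ->
  exists2 L, deg_lists B L & ~ colorable e B L.

(** Induction on the size of the block. Containment along edges makes all lists of a bad assignment
    equal, so [B] is regular of some degree [d]. In [B] minus a vertex [r], all non-root vertices of
    an end block turn out to be neighbors of [r]; two end blocks would give [r] at least
    [2 * (d - 1)] neighbors, which forces [d = 2]. *)
Lemma low_block B : B \subset Low -> nocut e B ->
  clique e B \/ {in B, forall v, degin e B v = 2}.
Proof.
have [n] := ubnP #|B|; elim: n B => // n IHn B; rewrite ltnS => leB sBL ncB.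
have [cB /forall_inP cutB] := andP ncB.
have [B0|[r rB]] := set_0Vmem B.
  by left; apply/cliqueP => x; rewrite B0 inE.
have [|L Ld nc] := low_bad sBL; first by apply/set0Pn; exists r.
have Lsub u v : u \in B -> v \in B -> e u v -> (L u `<=` L v)%fset.
  by move=> uB vB euv; apply: noncut_sublist euv Ld nc => //; apply: cutB.
have Lr : [set v in B | L v == L r] = B.
  move/connP: cB; apply; first by apply/set0Pn; exists r; rewrite inE rB eqxx.
  apply/closed_inP; split; first by apply/subsetP => x; rewrite inE => /andP[].
  move=> x y; rewrite !inE => /andP[xB /eqP <-] yB exy; rewrite yB eqEfsubset.
  by rewrite !Lsub // e_sym.
set d := #|` L r|.
have degB v : v \in B -> degin e B v = d.
  move=> vB; rewrite -(tight_lists cB Ld nc vB).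
  by move: vB; rewrite -{1}Lr inE => /andP[_ /eqP->].
clearbody d; have [d2|d2] := eqVneq d 2; first by right=> v /degB->.
left; set S := B :\ r; have cS : conn e S := cutB r rB.
have cardB : #|B| = #|S|.+1 by rewrite (cardsD1 r B) rB.
have [le1|gt1] := leqP #|S| 1.
  apply/cliqueP => x y xB yB xy.
  have [|||u [w [/set1P-> wB]]] := @conn_exit _ _ _ [set x] cB.
  - by rewrite sub1set.
  - by apply/set0Pn; exists x; rewrite inE.
  - by apply: contraNneq xy => eqB; rewrite -eqB in_set1 eq_sym in yB.
  rewrite inE => wx; suff -> : y = w by [].
  apply/eqP; apply: contraLR le1 => yw; rewrite -ltnNge -ltnS -cardB.
  have /subset_leq_card : [set x; y; w] \subset B by rewrite !subUset !sub1set xB yB wB.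
  apply: leq_trans; rewrite setUC cardsU1 !inE cards2 xy (negPf wx) eq_sym.
  by rewrite (negPf yw).
have hb B' x' : hangs e B' x' S -> nocut e B' -> 1 < #|B'| -> exists r',
    [/\ 0 < r' < #|B'|, d = r'.+1, {in B' :\ x', forall w, e w r}
      & {in B', forall w, degin e B' w = r'}].
  move=> hB' ncB' gtB'; have [sB'S xB' /closed_inP[_ clB']] := and3P hB'.
  have [r' [r'B Hr']] : exists r', 0 < r' < #|B'| /\ {in B', forall w, degin e B' w = r'}.
    have [|||clq|reg] := IHn B'.
    - by apply: leq_ltn_trans (subset_leq_card sB'S) _; rewrite -cardB.
    - by apply: subset_trans sB'S (subset_trans (subsetDl _ _) sBL).
    - exact: ncB'.
    - exists #|B'|.-1; split; last by move=> w; apply: degin_clique.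
      by move: gtB'; clear; lia.
    - exists 2; split=> //=.
      have /set0Pn[w wB'] : B' != set0 by rewrite -card_gt0 ltnW.
      have := degin_le_card e (B' :\ w) w; have := reg w wB'.
      by rewrite (degin_D1 e w wB') e_irr (cardsD1 w B') wB'; clear; lia.
  have dE w : w \in B' :\ x' -> d = e w r + r'.
    move=> wB; have wB' : w \in B' by case/setD1P: wB.
    have wB0 : w \in B by move/(subsetP sB'S): wB' => /setD1P[].
    by rewrite -(degB w wB0) (degin_D1 e w rB) (hangs_degin hB' wB) Hr'.
  (* One non-neighbor of [r] would give [d = r'], hence no neighbor of [r] in [B' :\ x']. Only [x']
     would then link this set to the rest of [B], but [B] has no cut vertex. *)
  have adj w : w \in B' :\ x' -> e w r.
    move=> wB; apply: contraT => ewr.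
    have dr' : d = r' by rewrite (dE w wB) (negPf ewr).
    have nadj u : u \in B' :\ x' -> e u r = false.
      by move=> uB; have := dE u uB; rewrite dr' -{1}[r']add0n => /addIn; case: (e u r).
    have eqB : B' :\ x' = B :\ x'.
      have xB : x' \in B by move/(subsetP sB'S): xB' => /setD1P[].
      move/connP: (cutB x' xB); apply; first by apply/set0Pn; exists w.
      apply/closed_inP; split.
        by apply: setSD; apply: subset_trans sB'S (subsetDl _ _).
      move=> u v uB /setD1P[vx vB] euv; apply: (clB' _ _ uB) => //.
      rewrite !inE vx vB andbT /=; apply: contraTneq euv => ->.
      by rewrite nadj.
    have rx : r != x' by apply: contraTneq xB' => <-; apply/negP => /(subsetP sB'S);
      rewrite !inE eqxx.
    move/setP/(_ r): eqB; rewrite !inE rx rB => /(subsetP sB'S).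
    by rewrite !inE eqxx.
  exists r'; split=> //.
  have /card_gt0P[w wB] : 0 < #|B' :\ x'| by rewrite (cardsD1 x') xB' in gtB'.
  by rewrite (dE w wB) adj.
have /set0Pn[x0 x0S] : S != set0 by rewrite -card_gt0 ltnW.
have h0 : hangs e S x0 S.
  by apply/and3P; split=> //; apply/closed_inP; split.
have [B1 [x1 [h1 nc1 gtB1 _ _]]] := end_block e_sym cS gt1 h0.
have [r1 [r1B d1 adj1 deg1]] := hb _ _ h1 nc1 gtB1.
have [sB1S xB1 /closed_inP[_ cl1]] := and3P h1.
(* If [S] is a single block, its root is adjacent to [r] too: it has degree [d = r1 + 1] in [B] but
   only [r1] in [S]. *)
have [eqB1|neqB1] := eqVneq B1 S.
  apply: clique_full => // v vB; rewrite degB // -(degB r rB) cardB /=.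
  rewrite (degin_D1 e r rB) e_irr add0n -/S.
  congr #|pred_of_set _|; apply/setP => u; rewrite inE.
  case uS: (u \in S) => //=; rewrite e_sym.
  have [ux|ux] := eqVneq u x1; last by rewrite adj1 // !inE ux eqB1 uS.
  have uB : u \in B by case/setD1P: uS.
  have := degB u uB; rewrite (degin_D1 e u rB) -/S -eqB1 deg1 ?eqB1 // d1 -add1n.
  by move/addIn; case: (e u r).
(* Otherwise a second end block lies beyond [x1]: its non-root vertices are in a component [K] of
   [S :\: B1], which is attached to the rest of [S] through [x1] only. *)
have [K0 K00] : exists K0, K0 \in S :\: B1.
  apply/set0Pn; apply: contra neqB1; rewrite setD_eq0 => sSB.
  by rewrite eqEsubset sB1S.
have clS : closed_in e (S :\: B1) (S :\: B1) by apply/closed_inP.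
have [K [cK sK K0K kK]] := component e_sym clS K00.
have [sKS HK] := closed_inP _ _ _ cK.
have KB1 u : u \in K -> u \in S /\ u \notin B1 by move/(subsetP sKS)/setDP.
have Kx1 u w : u \in K -> w \in S -> w \notin K -> e u w -> w = x1.
  move=> uK wS wK euw; have [uS uB1] := KB1 u uK.
  have wB1 : w \in B1 by apply: contraR wK => wB1; apply: (HK u) => //; rewrite inE wB1.
  have ux : u != x1 by apply: contraNneq uB1 => ->.
  apply/eqP; apply: contraR uB1 => wx.
  suff: u \in B1 :\ x1 by case/setD1P.
  by apply: (cl1 w); [apply/setD1P|apply/setD1P|rewrite e_sym].
have x1K : x1 \notin K by apply: contraL xB1 => /KB1[].
have [w1 [w1K ew1]] : exists w, w \in K /\ e x1 w.
  have [|||u [w [uK wS wK euw]]] := @conn_exit _ _ _ K cS.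
  - by apply: subset_trans sKS (subsetDl _ _).
  - by apply/set0Pn; exists K0.
  - by apply: contraNneq x1K => ->; apply: (subsetP sB1S).
  by exists u; rewrite e_sym -(Kx1 u w).
have h2 : hangs e (x1 |: K) x1 S.
  apply/and3P; split; rewrite ?setU11 //.
    by rewrite subUset sub1set (subsetP sB1S) //=; apply: subset_trans sKS (subsetDl _ _).
  rewrite setU1K //; apply/closed_inP; split.
    apply/subsetP => u uK; rewrite !inE; have [uS uB1] := KB1 u uK.
    by have /setD1P[-> ->] := uS; rewrite !andbT; apply: contraNneq uB1 => ->.
  move=> u w uK /setD1P[wx wS] euw; apply: contraR wx => wK.
  by apply/eqP; apply: Kx1 wK euw.
have gt2 : 1 < #|x1 |: K|.
  by rewrite cardsU1 x1K add1n ltnS card_gt0; apply/set0Pn; exists K0.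
have [B2 [x2 [h2' nc2 gtB2 _ sB2]]] := end_block e_sym (conn_add e_sym kK w1K ew1) gt2 h2.
have [r2 [r2B dr2 adj2 deg2]] := hb _ _ h2' nc2 gtB2.
have [_ xB2 _] := and3P h2'.
rewrite setU1K // in sB2.
have : #|(B1 :\ x1) :|: (B2 :\ x2)| <= degin e B r.
  apply/subset_leq_card/subsetP => u; rewrite in_setU inE e_sym => /orP[] uB.
    rewrite adj1 // andbT; case/setD1P: uB => _ /(subsetP sB1S).
    by case/setD1P.
  by rewrite adj2 // andbT; have [/setD1P[]] := KB1 u (subsetP sB2 _ uB).
have dis : (B1 :\ x1) :&: (B2 :\ x2) = set0.
  apply/setP => u; rewrite inE [RHS]inE; apply/negP => /andP[/setD1P[_ uB1] uB2].
  by have [_] := KB1 u (subsetP sB2 _ uB2); rewrite uB1.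
rewrite cardsU dis cards0 subn0 degB //.
move: r1B r2B d2; rewrite (cardsD1 x1 B1) xB1 (cardsD1 x2 B2) xB2 => r1B r2B d2.
by move: #|B1 :\ x1| #|B2 :\ x2| r1B r2B d2 dr2 d1 => a b; clear; lia.
Qed.

End Blocks.

(** * Weights on the low graph *)

Section LowGraph.

Variables (T : finType) (e : rel T).
Hypotheses (e_sym : symmetric e) (e_irr : irreflexive e).
Implicit Types (A B C D M P R S U X : {set T}) (x y z v : T) (L : T -> {fset nat}).

(** For disjoint sets this is the number of edges between them; edges inside [S :&: A] count
    twice. *)
Definition degsum S A := \sum_(v in A) degin e S v.

Lemma degsumC A B : degsum A B = degsum B A.
Proof.
have E C D : degsum C D = \sum_(v in D) \sum_(u in C) e v u.
  apply: eq_bigr => v _; rewrite /degin -sum1_card big_mkcond [RHS]big_mkcond /=.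
  by apply: eq_bigr => u _; rewrite inE; case: (u \in C) => //=; case: (e v u).
rewrite !E exchange_big /=; apply: eq_bigr => v _; apply: eq_bigr => u _.
by rewrite e_sym.
Qed.

Lemma degsum_setIDl A S B : A \subset S -> degsum S B = degsum A B + degsum (S :\: A) B.
Proof. by move=> sAS; rewrite -big_split; apply: eq_bigr => v _; apply: degin_setID. Qed.

Lemma degsum_setIDr A S B : A \subset S -> degsum B S = degsum B A + degsum B (S :\: A).
Proof. by rewrite ![degsum B _]degsumC; apply: degsum_setIDl. Qed.

Lemma degsum_const A S r : {in A, forall v, degin e S v = r} -> degsum S A = #|A| * r.
Proof. by move=> H; rewrite /degsum (eq_bigr _ H) sum_nat_const. Qed.

Lemma degsum1 S x : degsum S [set x] = degin e S x.
Proof. exact: big_set1. Qed.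

Lemma degsum_remove X S : X \subset S ->
  degsum S S = degsum (S :\: X) (S :\: X) + degsum (S :\: X) X + degsum S X.
Proof.
move=> sXS; rewrite (degsum_setIDr S sXS) addnC; congr (_ + _).
by rewrite (degsum_setIDl _ sXS) addnC; congr (_ + _); apply: degsumC.
Qed.

Lemma hangs_degsum B x S A : hangs e B x S -> A \subset S :\: (B :\ x) -> 
  degsum (B :\ x) A = (x \in A) * degin e B x.
Proof.
move=> /and3P[sBS xB /closed_inP[sBx HB]] sA.
have z v : v \in A :\ x -> degin e (B :\ x) v = 0.
  case/setD1P => vx vA; apply: degin_eq0 => u uBx.
  have /setDP[vS] := subsetP sA v vA; apply: contra => evu.
  by apply: HB uBx _ _; rewrite ?in_setD1 ?vx ?vS // e_sym.
have z0 : degsum (B :\ x) (A :\ x) = 0.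
  by rewrite (degsum_const z) muln0.
have [xA|xA] := boolP (x \in A).
  rewrite mul1n (@degsum_setIDr [set x]) ?sub1set // z0 degsum1 addn0.
  by rewrite (degin_D1 e x xB) e_irr.
rewrite mul0n -z0; congr degsum; apply/setP => v; rewrite in_setD1.
by case: eqP => // ->; rewrite (negPf xA).
Qed.

Lemma conn_union A B x : conn e A -> conn e B -> x \in A -> x \in B -> conn e (A :|: B).
Proof.
move=> /connP cA /connP cB xA xB; apply/connP => C C0 /closed_inP[sC HC].
have sub D : (forall E, E != set0 -> closed_in e E D -> E = D) -> D \subset A :|: B ->
    C :&: D != set0 -> D \subset C.
  move=> cD sD CD0; apply/setIidPr; apply: cD => //; apply/closed_inP.
  split=> [|u v /setIP[uC uD] vD euv]; first exact: subsetIr.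
  by rewrite inE vD andbT; apply: HC uC _ euv; apply: (subsetP sD).
have both : x \in C -> C = A :|: B.
  move=> xC; apply/eqP; rewrite eqEsubset sC subUset.
  by rewrite !sub ?subsetUl ?subsetUr //; apply/set0Pn; exists x; rewrite inE xC.
have /set0Pn[y yC] := C0; apply: both.
have /setUP[yA|yB] := subsetP sC y yC.
  by apply: (subsetP (sub A _ _ _)); rewrite ?subsetUl //; apply/set0Pn; exists y; rewrite inE yC.
by apply: (subsetP (sub B _ _ _)); rewrite ?subsetUr //; apply/set0Pn; exists y; rewrite inE yC.
Qed.

Variables (m : nat) (Low : {set T}).
Hypothesis m_ge5 : 4 < m.

(** A copy of [K_{k-1}], as [m] stands for [k - 1]. *)
Definition kset D := clique e D && (#|D| == m).

Definition kcover S := [set v | [exists D : {set T}, [&& D \subset S, kset D & v \in D]]].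

Lemma kcoverP S v : reflect (exists D, [/\ D \subset S, kset D & v \in D]) (v \in kcover S).
Proof.
rewrite inE; apply: (iffP existsP) => -[D].
  by case/and3P; exists D.
by case=> *; exists D; apply/and3P.
Qed.

Lemma kcover_sub S : kcover S \subset S.
Proof. by apply/subsetP => v /kcoverP[D [/subsetP sD _ /sD]]. Qed.

Lemma sub_kcover S D : D \subset S -> kset D -> D \subset kcover S.
Proof. by move=> sD kD; apply/subsetP => v vD; apply/kcoverP; exists D. Qed.

Lemma kset_degin D v : kset D -> v \in D -> degin e D v = m.-1.
Proof. by move=> /andP[cD /eqP <-]; apply: degin_clique. Qed.

Lemma kset_degin_ge D S v : kset D -> D \subset S -> v \in D -> m.-1 <= degin e S v.
Proof. by move=> kD sD vD; rewrite -(kset_degin kD vD); apply: degin_sub. Qed.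

Lemma kcover_degin S v : v \in kcover S -> m.-1 <= degin e S v.
Proof. by case/kcoverP => D [sD kD vD]; apply: kset_degin_ge vD. Qed.

Lemma kcover_same S S' : S' \subset S ->
  (forall D, D \subset S -> kset D -> D \subset S') -> kcover S' = kcover S.
Proof.
move=> sS H; apply/setP => v; apply/kcoverP/kcoverP => -[D [sD kD vD]]; exists D; split=> //.
  exact: subset_trans sS.
exact: H.
Qed.

Hypothesis low_bad : forall B, B \subset Low -> B != set0 ->
  exists2 L, deg_lists e B L & ~ colorable e B L.
Hypothesis low_deg : {in Low, forall v, degin e Low v <= m}.
Hypothesis low_clique : forall D, D \subset Low -> clique e D -> #|D| <= m.

Lemma low_degin S v : S \subset Low -> v \in S -> degin e S v <= m.
Proof.
move=> sS vS; apply: leq_trans (low_deg (subsetP sS v vS)).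
exact: degin_sub.
Qed.

(** As [v] has degree at most [m], two such copies span at most [m + 1] vertices, so they overlap in
    at least [m - 1]. If they differ, their union has no cut vertex, but it is too large for a
    clique and its degrees are too large for a 2-regular graph. *)
Lemma kset_meet D D' v : D \subset Low -> D' \subset Low -> kset D -> kset D' ->
  v \in D -> v \in D' -> D = D'.
Proof.
move=> sD sD' kD kD' vD vD'; apply/eqP/negPn/negP => neq.
have [cD /eqP mD] := andP kD; have [cD' /eqP mD'] := andP kD'.
have sB : D :|: D' \subset Low by rewrite subUset sD.
have ltB : m < #|D :|: D'|.
  rewrite -[X in X < _]mD; apply: proper_card; rewrite properEneq subsetUl andbT.
  apply: contra neq => /eqP eqD; rewrite eq_sym eqEcard mD mD' leqnn andbT.
  by rewrite eqD subsetUr.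
have leB : #|D :|: D'| <= m.+1.
  have vB : v \in D :|: D' by rewrite inE vD.
  rewrite (cardsD1 v) vB add1n ltnS.
  apply: leq_trans (low_degin sB vB).
  apply/subset_leq_card/subsetP => u; rewrite !inE => /andP[uv uB]; rewrite uB /=.
  by case/orP: uB => uD; [move/cliqueP: cD | move/cliqueP: cD']; apply; rewrite // eq_sym.
have clD1 C y : clique e C -> conn e (C :\ y).
  move=> /cliqueP cC; apply: clique_conn; apply/cliqueP => a b /setD1P[_ aC] /setD1P[_ bC].
  exact: cC.
have big : 1 < #|D :&: D'|.
  by have := cardsUI D D'; rewrite mD mD'; move: leB m_ge5; clear; lia.
have ncB : nocut e (D :|: D').
  apply/andP; split.
    by apply: conn_union vD vD'; apply: clique_conn.
  apply/forall_inP => y _; rewrite setDUl.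
  have /card_gt0P[w /setD1P[wy /setIP[wD wD']]] : 0 < #|(D :&: D') :\ y|.
    by have := cardsD1 y (D :&: D'); case: (y \in _) => /=; move: big; clear; lia.
  by apply: (@conn_union _ _ w); rewrite ?clD1 // in_setD1 wy.
have [clB|reg] := low_block e_sym e_irr low_bad sB ncB.
  by have := low_clique sB clB; rewrite leqNgt ltB.
have := kset_degin_ge kD (subsetUl D D') vD; rewrite reg; last by rewrite inE vD.
by move: m_ge5; clear; lia.
Qed.

Lemma kset_degin_out D S v : kset D -> D \subset S -> S \subset Low -> v \in D ->
  degin e (S :\: D) v <= 1.
Proof.
move=> kD sD sS vD; have := low_degin sS (subsetP sD v vD).
by rewrite (degin_setID e v sD) (kset_degin kD vD); move: m_ge5; clear; lia.
Qed.

Lemma degsum_single A B x : x \in B -> {in B :\ x, forall v, degin e A v = 0} ->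
  degsum A B = degin e A x.
Proof.
move=> xB z; rewrite (@degsum_setIDr [set x]) ?sub1set // degsum1.
by rewrite (degsum_const z) muln0 addn0.
Qed.

(** For a component [A] of [kcover S], this says that [A] is not a component of [S]. *)
Definition exits S A :=
  [exists z in A, exists u in S :\: kcover S, e z u].

(* [R] meets every component of [kcover S], and [P] meets every such component that
   is also a component of [S]; so [#|R|] and [#|P|] bound the numbers of clusters
   from above. *)
Definition reps S R P := forall A, A != set0 -> closed_in e A (kcover S) ->
  (A :&: R != set0) && ((A :&: P != set0) || exits S A).

Section Weights.

Variables kap h : rat.
Local Open Scope ring_scope.

(** If every vertex of [S] has degree [m] in the whole graph, this is the number of edges that leave
    [S], those from [kcover S] counted [1 + h] times, minus [kap] per vertex of [S]. *)
Definition phi S : rat :=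
  #|S|%:R * (m%:R - kap) - (degsum S S)%:R
  + h * (m%:R * #|kcover S|%:R - (degsum S (kcover S))%:R).

(** The edges from [x] into the block are counted again from the side of [x], which costs [r] more,
    and a further [h * r] when [x] lies in a copy of [K_{k-1}]. *)
Lemma phi_pendant S B x r : hangs e B x S -> {in B, forall v, degin e B v = r} ->
  [disjoint B :\ x & kcover S] ->
  let S' := S :\: (B :\ x) in
  kcover S' = kcover S /\
  phi S = phi S' + (#|B :\ x|%:R * (m%:R - kap - r%:R) - r%:R - h * ((x \in kcover S) * r)%:R).
Proof.
move=> hB dB dis S'; have [sBS xB _] := and3P hB.
have sX : B :\ x \subset S by apply: subset_trans sBS; apply: subsetDl.
have sW : kcover S \subset S'.
  rewrite subsetD kcover_sub /=; move: dis; rewrite disjoint_sym => dis.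
  by [].
have eqW : kcover S' = kcover S.
  apply: kcover_same => [|D sD kD]; first exact: subsetDl.
  exact: subset_trans (sub_kcover sD kD) sW.
split=> //; rewrite /phi eqW.
have cS : (#|S| = #|S'| + #|B :\ x|)%N.
  by rewrite (cardsD S (B :\ x)) (setIidPr sX) subnK // subset_leq_card.
have dS : degsum S S = (degsum S' S' + r + #|B :\ x| * r)%N.
  rewrite (degsum_remove sX) -/S' (degsumC S' (B :\ x)) (hangs_degsum hB) ?subxx //.
  rewrite inE setD11 (subsetP sBS) // mul1n dB //; congr (_ + _)%N.
  apply: degsum_const => v vX; rewrite (hangs_degin hB vX) dB //.
  by case/setD1P: vX.
have dW : degsum S (kcover S) = (degsum S' (kcover S) + (x \in kcover S) * r)%N.
  rewrite (degsum_setIDl _ sX) -/S' addnC; congr (_ + _)%N.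
  by rewrite (hangs_degsum hB sW) dB.
by rewrite cS dS dW !natrD !natrM; ring.
Qed.

Lemma reps_same S S' R P : S' \subset S -> kcover S' = kcover S ->
  reps S' R P -> reps S R P.
Proof.
move=> sS eqW rS' A A0; rewrite -eqW => /(rS' _ A0)/andP[-> /=].
case/orP=> [->//|/exists_inP[z zA /exists_inP[u /setDP[uS' uW] ezu]]].
apply/orP; right; apply/exists_inP; exists z => //; apply/exists_inP; exists u => //.
by rewrite inE (subsetP sS) // -eqW uW.
Qed.

Lemma kcover_kset S B : S \subset Low -> B \subset S -> kset B ->
  kcover S = kcover (S :\: B) :|: B.
Proof.
move=> sSL sBS kB; apply/setP => v; rewrite in_setU.
apply/kcoverP/orP => [[D [sD kD vD]]|[/kcoverP[D [sD kD vD]]|vB]]; last by exists B.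
  have [vB|vB] := boolP (v \in B); first by right.
  left; apply/kcoverP; exists D; split=> //; apply/subsetP => u uD.
  rewrite inE (subsetP sD) // andbT; apply: contra vB => uB.
  by rewrite -(@kset_meet D B u) // (subset_trans _ sSL).
by exists D; split=> //; apply: subset_trans sD (subsetDl _ _).
Qed.

Lemma phi_kset S B x : S \subset Low -> hangs e B x S -> kset B ->
  let S' := S :\: B in
  phi S = phi S' + (m%:R * (1 - kap) - 2 * (degin e S' x)%:R
    + h * (m%:R - (degin e S' x)%:R - (degin e (kcover S') x)%:R)).
Proof.
move=> sSL hB kB S'; have [sBS xB _] := and3P hB.
have [clB /eqP cB] := andP kB.
have z v : v \in B :\ x -> degin e S' v = 0%N.
  move=> vB; have := hangs_degin hB vB; rewrite (degin_setID e v sBS) -/S'.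
  by rewrite -[RHS]addn0 => /addnI.
have z' v : v \in B :\ x -> degin e (kcover S') v = 0%N.
  by move=> /z z0; apply/eqP; rewrite -leqn0 -z0 degin_sub // kcover_sub.
have cS : (#|S| = #|S'| + m)%N.
  by rewrite -cB (cardsD S B) (setIidPr sBS) subnK // subset_leq_card.
have dB : degsum S B = (m * m.-1 + degin e S' x)%N.
  rewrite (degsum_setIDl _ sBS) -/S' (degsum_single xB z); congr (_ + _)%N.
  by rewrite -cB (degsum_const (r := m.-1)) ?cB // => v vB; apply: kset_degin.
have dS : degsum S S = (degsum S' S' + degin e S' x + (m * m.-1 + degin e S' x))%N.
  by rewrite (degsum_remove sBS) -/S' (degsum_single xB z) dB.
have dis : [disjoint kcover S' & B].
  by apply: disjointWl (kcover_sub _) _; rewrite -setI_eq0 setIDAC setDIl setDv setI0.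
have W : kcover S = kcover S' :|: B := kcover_kset sSL sBS kB.
have cW : #|kcover S| = (#|kcover S'| + m)%N.
  by rewrite W cardsU; move: dis; rewrite -setI_eq0 => /eqP->; rewrite cards0 subn0 cB.
have dW : degsum S (kcover S) = (degsum S' (kcover S') + degin e (kcover S') x
    + (m * m.-1 + degin e S' x))%N.
  rewrite W (_ : degsum S (_ :|: _) = degsum S (kcover S') + degsum S B)%N; last first.
    rewrite (@degsum_setIDr (kcover S')) ?subsetUl // setDUl setDv set0U.
    by congr (_ + degsum S _)%N; apply/setDidPl; rewrite disjoint_sym.
  rewrite dB; congr (_ + _)%N.
  by rewrite (degsum_setIDl _ sBS) -/S' addnC (degsumC B) (degsum_single xB z').
have mE : m.-1%:R = m%:R - 1 :> rat by rewrite -subn1 natrB // (leq_trans _ m_ge5).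
by rewrite /phi cS dS cW dW !natrD !natrM mE; ring.
Qed.

Lemma pick_end_block S : S != set0 -> exists B x,
  [/\ hangs e B x S, nocut e B & (1 < #|B|)%N \/ B = [set x] /\ degin e S x = 0%N].
Proof.
move=> /set0Pn[x0 x0S]; have clS : closed_in e S S by apply/closed_inP.
have [C [clC sC x0C cC]] := component e_sym clS x0S.
have [_ HC] := closed_inP _ _ _ clC.
have hC : hangs e C x0 S.
  apply/and3P; split=> //; apply/closed_inP; split; first exact: setSD.
  move=> u v /setD1P[_ uC] /setD1P[vx vS] euv.
  by rewrite in_setD1 vx (HC u).
have [le1|gt1] := leqP #|C| 1; last first.
  have [B [x [hB ncB gtB _ _]]] := end_block e_sym cC gt1 hC.
  by exists B, x; split=> //; left.
have eqC : C = [set x0].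
  by apply/eqP; rewrite eq_sym eqEcard sub1set x0C cards1.
have conn0 : conn e set0.
  by apply/connP => A A0 /closed_inP[]; rewrite subset0 => /eqP eqA; rewrite eqA eqxx in A0.
exists C, x0; split=> //; last first.
  right; split=> //; apply: degin_eq0 => u uS; apply/negP => eu.
  have := HC x0 u x0C uS eu; rewrite eqC => /set1P eu0.
  by rewrite eu0 e_irr in eu.
apply/andP; split=> //; apply/forall_inP => y.
by rewrite eqC => /set1P->; rewrite setDv.
Qed.

Hypothesis kap_ge1 : 1 <= kap.
Hypothesis kap_le2 : kap <= 2.
Hypothesis h_ge1 : 1 <= h.
Hypothesis h_le2 : h <= 2.
(** This equation and the next make two removals break even exactly: that of a copy of [K_{k-1}]
    with one edge to the rest, and that of a marked vertex whose only neighbor lies in a copy of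
    [K_{k-1}]. *)
Hypothesis kset_balance : (1 + h) * (m%:R - 2) = kap * m%:R.
Hypothesis mark_balance : (m%:R - 1) * (2 - kap) = 2 + h.

Variable s : rat.
Hypothesis sE : s = (m%:R - 2) * (kap - 1).

Lemma mark_weight : m%:R - kap - s = 2 + h.
Proof. by rewrite -mark_balance sE; ring. Qed.

Lemma mark_weight_ge0 : 0 <= s.
Proof.
rewrite sE mulr_ge0 ?subr_ge0 // ler_nat; exact: leq_trans m_ge5.
Qed.

(** This is the step of [low_weight] that removes a copy of [K_{k-1}]. The copy is a new cluster,
    represented by [x], unless [x] is joined to an older cluster; [x] enters [P] as well when it has
    no neighbor outside the copy. *)
Lemma low_weight_kset S M B x : S \subset Low -> M \subset S ->
  {in M, forall v, degin e S v <= 2}%N -> hangs e B x S -> kset B ->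
  (forall M', M' \subset S :\: B -> {in M', forall v, degin e (S :\: B) v <= 2}%N ->
    exists R P, reps (S :\: B) R P /\
      h * (#|R| + 2 * #|P|)%:R + s * #|M'|%:R <= phi (S :\: B)) ->
  exists R P, reps S R P /\ h * (#|R| + 2 * #|P|)%:R + s * #|M|%:R <= phi S.
Proof.
move=> sSL sMS dM hB kB IH; have [sBS xB _] := and3P hB.
have [clB _] := andP kB.
set S' := S :\: B in IH *; have sS' : S' \subset S by apply: subsetDl.
have sMS' : M \subset S'.
  apply/subsetP => v vM; rewrite inE (subsetP sMS) // andbT; apply/negP => vB.
  have := leq_trans (kset_degin_ge kB sBS vB) (dM v vM).
  by move: m_ge5; clear; lia.
have [|R [P [rRP le]]] := IH M sMS'.
  by move=> v vM; apply: leq_trans (dM v vM); apply: degin_sub.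
set t := degin e S' x; set t' := degin e (kcover S') x.
have let1 : (t <= 1)%N by apply: kset_degin_out.
have let' : (t' <= t)%N by apply: degin_sub; apply: kcover_sub.
have W : kcover S = kcover S' :|: B := kcover_kset sSL sBS kB.
exists (if t' == 0%N then x |: R else R), (if t == 0%N then x |: P else P); split.
  move=> A A0 cA; have [sA HA] := closed_inP _ _ _ cA.
  have [AW0|AW0] := eqVneq (A :&: kcover S') set0.
    have sAB : A \subset B.
      apply/subsetP => v vA; have := subsetP sA v vA; rewrite W => /setUP[vW|//].
      by move/setP/(_ v): AW0; rewrite inE vA vW inE.
    have xA : x \in A.
      apply: (subsetP (conn_clique_sub clB (sub_kcover sBS kB) cA _)) => //.
      by rewrite (setIidPl sAB).
    have t'0 : t' = 0%N.
      apply: degin_eq0 => u uW; apply/negP => exu.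
      have uW' : u \in kcover S by rewrite W inE uW.
      by move/setP/(_ u): AW0; rewrite inE (HA x) // uW inE.
    rewrite t'0 eqxx; apply/andP; split.
      by apply/set0Pn; exists x; rewrite inE xA setU11.
    have [t0|tn0] := eqVneq t 0%N.
      by apply/orP; left; apply/set0Pn; exists x; rewrite inE xA setU11.
    apply/orP; right; rewrite -lt0n in tn0; have /card_gt0P[u] := tn0.
    rewrite inE => /andP[uS' exu].
    apply/exists_inP; exists x => //; apply/exists_inP; exists u => //.
    have /setDP[uS uB] := uS'; rewrite in_setD uS andbT W in_setU negb_or uB andbT.
    apply/negP => uW; have := degin_gt0 uW exu.
    by rewrite -/t' t'0.
  have cA' : closed_in e (A :&: kcover S') (kcover S').
    apply/closed_inP; split=> [|u v /setIP[uA uW] vW euv]; first exact: subsetIr.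
    by rewrite inE vW andbT (HA u) // W inE vW.
  have /andP[AR AP] := rRP _ AW0 cA'.
  apply/andP; split.
    have /set0Pn[r /setIP[/setIP[rA _] rR]] := AR.
    by apply/set0Pn; exists r; rewrite inE rA; case: ifP => _ //; rewrite inE rR orbT.
  case/orP: AP => [/set0Pn[r /setIP[/setIP[rA _] rR]]|].
    apply/orP; left; apply/set0Pn; exists r; rewrite inE rA.
    by case: ifP => _ //; rewrite inE rR orbT.
  case/exists_inP => z /setIP[zA _] /exists_inP[u /setDP[/setDP[uS uB] uW] ezu].
  apply/orP; right; apply/exists_inP; exists z => //; apply/exists_inP; exists u => //.
  by rewrite in_setD uS W in_setU negb_or uB uW.
have leR : (#|if t' == 0%N then x |: R else R| <= #|R| + (t' == 0%N))%N.
  by case: ifP => _; rewrite ?addn0 // cardsU1 addnC leq_add2l leq_b1.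
have leP : (#|if t == 0%N then x |: P else P| <= #|P| + (t == 0%N))%N.
  by case: ifP => _; rewrite ?addn0 // cardsU1 addnC leq_add2l leq_b1.
rewrite (phi_kset sSL hB kB) -/S' -/t -/t'.
have h0 : 0 <= h by apply: le_trans h_ge1.
have {leR leP} : h * (#|if t' == 0%N then x |: R else R| + 2 * #|if t == 0%N then x |: P else P|)%:R
    <= h * (#|R| + 2 * #|P| + ((t' == 0%N) + 2 * (t == 0%N)))%:R.
  by apply: ler_wpM2l => //; rewrite ler_nat; move: leR leP; clear; lia.
rewrite natrD mulrDr.
suff : h * ((t' == 0%N) + 2 * (t == 0%N))%:R <=
    m%:R * (1 - kap) - 2 * t%:R + h * (m%:R - t%:R - t'%:R).
  by move: le; lra.
(* The cases are [t = t' = 0], which needs [h <= 2], and [t = 1] with [t'] equal to 0 or 1, where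
   [kset_balance] gives equality. *)
move: let1 let' kset_balance h_le2 h_ge1.
case: t => [|[|//]]; first by rewrite leqn0 => _ /eqP-> /=; rewrite mulr0n; lra.
by case: t' => [|[|//]] _ _ /=; rewrite ?mulr0n ?mulr1n; lra.
Qed.

(* A vertex in [M] stands for a removed end block [K_{k-2}] that hung on it; [s] is
   the deficit of this block. *)
Lemma low_weight S M : S \subset Low -> M \subset S ->
  {in M, forall v, degin e S v <= 2}%N ->
  exists R P, reps S R P /\ h * (#|R| + 2 * #|P|)%:R + s * #|M|%:R <= phi S.
Proof.
have s0 := mark_weight_ge0; have sW := mark_weight.
have [n] := ubnP #|S|; elim: n S M => // n IHn S M; rewrite ltnS => leS sSL sMS dM.
have [S0|Sn0] := eqVneq S set0.
  have W0 : kcover S = set0 by apply/eqP; rewrite -subset0 -S0 kcover_sub.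
  exists set0, set0; split.
    move=> A A0 /closed_inP[]; rewrite W0 subset0 => /eqP eqA.
    by rewrite eqA eqxx in A0.
  have -> : M = set0 by apply/eqP; rewrite -subset0 -S0.
  by rewrite /phi W0 S0 cards0 /degsum !big_set0 !mulr0 !mul0r; lra.
(* The induction removes an isolated vertex or an end block without its root; only copies of
   [K_{k-1}] are removed whole. *)
have [B [x [hB ncB [gtB|[eqB dx0]]]]] := pick_end_block Sn0; last first.
  have [sBS xB _] := and3P hB; have xS := subsetP sBS x xB.
  have sx : [set x] \subset S by rewrite sub1set.
  have degW D : kset D -> x \in D -> D \subset S -> false.
    move=> kD xD sD; have := kset_degin_ge kD sD xD; rewrite dx0; move: m_ge5.
    by clear; lia.
  have dx A : A \subset S -> degin e A x = 0%N.
    by move=> sA; have := degin_sub e x sA; rewrite dx0 leqn0 => /eqP.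
  have eqW : kcover (S :\ x) = kcover S.
    apply: kcover_same => [|D sD kD]; first exact: subsetDl.
    by rewrite subsetD1 sD; apply/negP => xD; have := degW D kD xD sD.
  have [||||R [P [rRP le]]] := IHn (S :\ x) (M :\ x).
  - by rewrite (cardsD1 x S) xS in leS.
  - by apply: subset_trans sSL; apply: subsetDl.
  - exact: setSD.
  - move=> v /setD1P[_ vM]; apply: leq_trans (dM v vM).
    by apply: degin_sub; apply: subsetDl.
  exists R, P; split; first by apply: reps_same rRP => //; apply: subsetDl.
  have -> : phi S = phi (S :\ x) + (m%:R - kap).
    rewrite /phi eqW (degsum_remove sx) !degsum1 dx0 dx ?subsetDl //.
    rewrite (degsum_setIDl (kcover S) sx) (degsumC [set x]) degsum1 dx ?kcover_sub //.
    by rewrite (cardsD1 x S) xS add1n -addn1 !natrD !addr0 add0r; ring.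
  have : #|M|%:R <= 1 + #|M :\ x|%:R :> rat.
    by rewrite -(natrD _ 1%N) ler_nat (cardsD1 x M); case: (x \in M).
  move/(ler_wpM2l s0); move: le sW h_ge1; rewrite mulrDr mulr1; lra.
have [sBS xB _] := and3P hB; have xS := subsetP sBS x xB.
have sBL := subset_trans sBS sSL.
have sX : B :\ x \subset S by apply: subset_trans sBS; apply: subsetDl.
have cB : #|B| = #|B :\ x|.+1 by rewrite (cardsD1 x B) xB.
have leB := low_clique sBL.
have [kB|nkB] := boolP (kset B).
  apply: (low_weight_kset sSL sMS dM hB kB) => M' sM' dM'; apply: IHn => //.
    by apply: leq_trans leS; rewrite (cardsD S B) (setIidPr sBS) ltn_subrL cB card_gt0 Sn0.
  by apply: subset_trans sSL; apply: subsetDl.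
have [r [dB r1 rC]] : exists r, [/\ {in B, forall v, degin e B v = r}, (0 < r)%N &
    (r = #|B :\ x| /\ r <= m.-2 \/ r = 2 /\ 1 < #|B :\ x|)%N].
  have [clB|reg] := low_block e_sym e_irr low_bad sBL ncB.
    exists #|B :\ x|; split=> [v vB||]; first by rewrite (degin_clique e_irr clB vB) cB.
      by rewrite cB in gtB.
    left; split=> //; move: (leB clB) nkB; rewrite /kset clB cB /=.
    by move: m_ge5; clear; lia.
  exists 2; split=> //; right; split=> //.
  have := degin_le_card e (B :\ x) x; have := reg x xB.
  by rewrite (degin_D1 e x xB) e_irr add0n => ->.
have ltr : (r < m.-1)%N by case: rC => [[_]|[->]]; move: m_ge5; clear; lia.
have dis : [disjoint B :\ x & kcover S].
  apply/pred0P => v /=; apply/negP => /andP[vX /kcover_degin].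
  have vB : v \in B by case/setD1P: vX.
  by rewrite (hangs_degin hB vX) dB // leqNgt ltr.
have [eqW phiE] := phi_pendant hB dB dis.
set S' := S :\: (B :\ x) in eqW phiE.
have sS' : S' \subset S by apply: subsetDl.
have xS' : x \in S' by rewrite inE setD11.
have dxE : degin e S x = (r + degin e S' x)%N.
  by rewrite (degin_setID e x sX) -(dB x xB) (degin_D1 e x xB) e_irr.
have xk : x \in kcover S -> (r <= 1)%N.
  rewrite -eqW => /kcover_degin; have := low_degin sSL xS.
  by rewrite dxE; move: m_ge5; clear; lia.
have ltS' : (#|S'| < n)%N.
  apply: leq_trans leS; apply: proper_card; apply/properP; split=> //.
  have /card_gt0P[v vX] : (0 < #|B :\ x|)%N by rewrite cB in gtB.
  by exists v; [apply: (subsetP sX)|rewrite inE vX].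
have dS' v : (degin e S' v <= degin e S v)%N by apply: degin_sub.
have Mr v : v \in M -> v \in B :\ x -> (r <= 2)%N.
  move=> vM vX; have := dM v vM; rewrite (hangs_degin hB vX) dB //.
  by case/setD1P: vX.
(* A pendant [K_{k-2}] falls short by [s], so its root gets a mark; this is allowed because at most
   two neighbors of the root remain. *)
have [rm|rm] := eqVneq r m.-2.
  have r3 : (2 < r)%N by rewrite rm; move: m_ge5; clear; lia.
  have r_b : r = #|B :\ x| by case: rC => [[]//|[r2 _]]; rewrite r2 in r3.
  have xW : x \notin kcover S by apply: contraL r3 => /xk; clear; lia.
  have xM : x \notin M.
    by apply: contraL r3 => /dM; rewrite dxE; clear; lia.
  have dx2 : (degin e S' x <= 2)%N.
    by have := low_degin sSL xS; rewrite dxE rm; move: m_ge5; clear; lia.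
  have [|||R [P [rRP le]]] := IHn S' (x |: M) ltS'.
  - exact: subset_trans sSL.
  - rewrite subUset sub1set xS'; apply/subsetP => v vM.
    rewrite inE (subsetP sMS) // andbT; apply: contraL r3 => vX.
    by rewrite -leqNgt; apply: Mr vX.
  - by move=> v /setU1P[->//|/dM]; apply: leq_trans.
  exists R, P; split; first exact: reps_same rRP.
  move: le; rewrite phiE (negPf xW) mul0n -r_b rm cardsU1 xM add1n -natr1.
  have -> : m.-2%:R = m%:R - 2 :> rat.
    by rewrite -subn2 natrB //; move: m_ge5; clear; lia.
  by move: sE; lra.
have [|||R [P [rRP le]]] := IHn S' (M :\: (B :\ x)) ltS'.
- exact: subset_trans sSL.
- exact: setSD.
- by move=> v /setDP[vM _]; apply: leq_trans (dS' v) (dM v vM).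
exists R, P; split; first exact: reps_same rRP.
suff gain : s * #|M :&: (B :\ x)|%:R <=
    #|B :\ x|%:R * (m%:R - kap - r%:R) - r%:R - h * ((x \in kcover S) * r)%:R.
  by rewrite phiE -(cardsID (B :\ x) M) natrD mulrDr; move: le gain; lra.
have leM : (#|M :&: (B :\ x)| <= #|B :\ x|)%N by apply/subset_leq_card/subsetIr.
(* If [3 <= r <= m - 3], no removed vertex is marked and the gain is [r * (m - r - 1 - kap)], which
   is nonnegative by [kap <= 2]. *)
have [r3|r2] := ltnP 2 r.
  have r_b : r = #|B :\ x| by case: rC => [[]//|[r2 _]]; rewrite r2 in r3.
  have xW : x \notin kcover S by apply: contraL r3 => /xk; clear; lia.
  have -> : M :&: (B :\ x) = set0.
    apply/setP => v; rewrite !in_set0 in_setI; apply/negP => /andP[vM vX].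
    by have := Mr v vM vX; rewrite leqNgt r3.
  have lerm : (r + 3 <= m)%N.
    by case: rC rm => [[_]|[r2 _]]; [move: m_ge5; clear; lia | rewrite r2 in r3].
  rewrite (negPf xW) mul0n cards0 -r_b !mulr0 subr0.
  have : 0 <= r%:R * (m%:R - r%:R - 1 - kap).
    rewrite mulr_ge0 // subr_ge0; apply: le_trans kap_le2 _.
    by move: lerm; rewrite -(ler_nat rat) natrD; lra.
  by lra.
(* For [r] equal to 1 or 2, all removed vertices may be marked. A pendant edge is paid for by
   [mark_balance]; in a cycle, each of the at least two removed vertices has [h >= 1] to spare,
   which covers the cost 2 at the root. *)
have {}sM : s * #|M :&: (B :\ x)|%:R <= s * #|B :\ x|%:R.
  by apply: ler_wpM2l => //; rewrite ler_nat.
apply: le_trans sM _.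
have [r_1|r_n1] := eqVneq r 1%N.
  have b1 : #|B :\ x| = 1%N by case: rC => [[<-]|[]]; rewrite r_1.
  rewrite b1 r_1 muln1 !mulr1 mul1r; case: (x \in kcover S); rewrite ?mulr1 ?mulr0;
    by move: sW h_ge1; lra.
have r_2 : r = 2 by move: r1 r2 r_n1; clear; lia.
have xW : x \notin kcover S by apply/negP => /xk; rewrite r_2.
have b2 : (2 <= #|B :\ x|)%N by case: rC => [[<- _]|[]//]; rewrite r_2.
rewrite (negPf xW) mul0n mulr0 subr0 r_2.
have {b2} : 2 * h <= #|B :\ x|%:R * h.
  by apply: ler_wpM2r; [exact: le_trans h_ge1|rewrite ler_nat].
have -> : h = m%:R - kap - s - 2 by move: sW; lra.
have : 2 <= 2 * h by move: h_ge1; lra.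
have -> : h = m%:R - kap - s - 2 by move: sW; lra.
lra.
Qed.

End Weights.

(** * Propagation of lists through an uncolorable cluster *)

(** All neighbors of [z] lie in the clique [D], so paths through [z] can be shortcut inside [D]. *)
Lemma clique_exit_conn U D z : conn e U -> clique e D -> D \subset U -> z \in D ->
  degin e (U :\: D) z = 0 -> conn e (U :\ z).
Proof.
move=> /connP cU clD sDU zD z0.
have znb v : v \in U -> e z v -> v \in D.
  move=> vU ezv; apply: contraT => vD.
  have vUD : v \in U :\: D by rewrite inE vD.
  by have := degin_gt0 vUD ezv; rewrite z0.
apply/connP => A A0 cA; have [sA HA] := closed_inP _ _ _ cA.
have sAU : A \subset U by apply: subset_trans sA (subsetDl _ _).
have zA : z \notin A by apply/negP => /(subsetP sA); rewrite !inE eqxx.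
have [AD0|AD0] := eqVneq (A :&: (D :\ z)) set0.
  have eqA : A = U.
    apply: cU => //; apply/closed_inP; split=> // x y xA yU exy.
    apply: (HA x) => //; rewrite in_setD1 yU andbT; apply: contraTneq exy => ->.
    apply/negP => exz; have xD : x \in D by rewrite znb ?(subsetP sAU) // e_sym.
    move/setP/(_ x): AD0; rewrite !inE xA xD andbT /=.
    by move/negbFE/eqP => xz; rewrite -xz xA in zA.
  by rewrite eqA (subsetP sDU) in zA.
have sDA : D :\ z \subset A.
  apply: (@conn_clique_sub _ e A (U :\ z)) => //; last exact: setSD.
  by apply/cliqueP => x y /setD1P[_ xD] /setD1P[_ yD]; apply: (cliqueP _ _ clD).
have <- : z |: A = U; last by rewrite setU1K.
apply: cU; first by apply/set0Pn; exists z; rewrite setU11.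
apply/closed_inP; split; first by rewrite subUset sub1set (subsetP sDU).
move=> x y /setU1P[->|xA] yU exy.
  have yD := znb y yU exy; rewrite in_setU1; have [//|yz] := eqVneq y z.
  by rewrite (subsetP sDA) // !inE yz.
by rewrite in_setU1; have [//|yz] := eqVneq y z; rewrite (HA x) // !inE yz.
Qed.

(** A coloring of [C] that avoids [a] at [u'] could be combined with [a] at [u]. As [a] is missing
    in [L z], the vertex [z] would have a surplus, and the rest of [U] could be colored greedily
    toward [z]. *)
Lemma uncolorable_branch U D C L z u u' a :
  U \subset Low -> conn e U -> deg_lists e U L -> ~ colorable e U L ->
  kset D -> D \subset U -> z \in D -> u \in D -> u' \in C -> e u u' ->
  closed_in e C (U :\: D) -> a \in L u -> a \notin L z ->
  ~ colorable e C (fun v => if v == u' then L v `\ a else L v)%fset.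
Proof.
move=> sUL cU Ld nc kD sDU zD uD u'C euu' clC aLu aLz [c pc cL]; apply: nc.
have [sC HC] := closed_inP _ _ _ clC.
have CD v : v \in C -> v \notin D by move=> /(subsetP sC) /setDP[].
have CU : C \subset U by apply: subset_trans sC (subsetDl _ _).
have uU := subsetP sDU u uD; have zU := subsetP sDU z zD.
have uC : u \notin C by apply: contraL uD => /CD.
have zu : z != u by apply: contraNneq aLz => ->.
have [clD _] := andP kD.
have uout v : v \in U :\: D -> e u v -> v = u'.
  move=> vUD euv; apply/eqP; apply: contraT => vu'.
  have := kset_degin_out kD sDU sUL uD.
  rewrite (degin_D1 e u vUD) euv (@degin_D1 _ e _ u u'); last first.
    by rewrite in_setD1 eq_sym vu' (subsetP sC).
  by rewrite euu'.
pose c' v := if v == u then a else c v.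
have c'C v : v \in C -> c' v = c v by rewrite /c'; case: eqP => // -> ; rewrite (negPf uC).
have c'u : c' u = a by rewrite /c' eqxx.
have sQ : u |: C \subset U by rewrite subUset sub1set uU.
apply: (@colorable_extend _ _ e_sym (u |: C) _ c') => //.
- have pu v : v \in C -> e u v -> a != c v.
    move=> vC euv; have -> := uout v (subsetP sC v vC) euv.
    by have := cL u' u'C; rewrite /= eqxx in_fsetD1 eq_sym => /andP[].
  move=> x y /setU1P[->|xC] /setU1P[->|yC] exy.
  + by rewrite e_irr in exy.
  + by rewrite c'u c'C // pu.
  + by rewrite c'u c'C // eq_sym pu // e_sym.
  + by rewrite !c'C // pc.
- move=> x /setU1P[->|xC]; first by rewrite c'u.
  by rewrite c'C //; have := cL x xC; rewrite /=; case: eqP => // _; rewrite in_fsetD1 => /andP[].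
apply: degenerate_colorable => // A sA A0.
have AQ v : v \in A -> [/\ v \in U, v != u & v \notin C].
  by move=> /(subsetP sA); rewrite !inE negb_or -andbA => /and3P[].
have sAQ : A :|: (u |: C) \subset U.
  by rewrite subUset sQ andbT; apply: subset_trans sA (subsetDl _ _).
have dis : [disjoint A & u |: C].
  apply/pred0P => v /=; apply/negP => /andP[/AQ[_ vu vC]].
  by rewrite !inE (negPf vu) (negPf vC).
have slack v t : v \in A -> t \in U -> t \notin A -> t \notin u |: C -> e v t ->
    degin e A v < #|` avail e (u |: C) c' L v|.
  move=> vA tU tA tQ evt; have [vU _ _] := AQ v vA.
  have tAQ : t \notin A :|: (u |: C) by rewrite inE negb_or tA.
  have := degin_exit sAQ tU tAQ evt; rewrite (degin_disj _ _ dis).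
  have := card_avail e (u |: C) c' L v; have := Ld v vU; clear; lia.
have zQ : z \notin u |: C by rewrite !inE (negPf zu); apply: contraL zD => /CD.
have [zA|zA] := boolP (z \in A).
  exists z => //; have ezu : e z u by apply: (cliqueP _ _ clD).
  have := degin_sub e z sAQ; rewrite (degin_disj _ _ dis).
  have c'uL : c' u \notin L z by rewrite c'u.
  have := card_avail_missed (setU11 u C) ezu c'uL.
  have := Ld z zU; clear; lia.
have [AD0|/set0Pn[v /setIP[vA vD]]] := eqVneq (A :&: D) set0; last first.
  exists v => //; apply: (slack v z) => //.
  by apply: (cliqueP _ _ clD) => //; apply: contraNneq zA => <-.
have sAU : A \subset U by apply: subset_trans sA (subsetDl _ _).
have [|v [t [vA tU tA evt]]] := conn_exit cU sAU A0.
  by apply: contraNneq zA => ->.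
have [vU vu vC] := AQ v vA.
have vUD : v \in U :\: D.
  rewrite inE vU andbT; apply/negP => vD.
  by move/setP/(_ v): AD0; rewrite inE vA vD inE.
exists v => //; apply: (slack v t) => //.
rewrite !inE negb_or; apply/andP; split.
  apply: contraNneq vC => tu; rewrite (uout v vUD) //.
  by rewrite e_sym -tu.
by apply: contra vC => tC; apply: (HC t) => //; rewrite e_sym.
Qed.

(* Once a bad cluster is known at one vertex without outside edges, its colors
   propagate along the linking edges to every other vertex. *)
Lemma forced_list U L1 L2 z w : U \subset Low -> conn e U -> U \subset kcover U ->
  deg_lists e U L1 -> deg_lists e U L2 -> ~ colorable e U L1 -> ~ colorable e U L2 ->
  z \in U -> w \in U -> degin e U z = m.-1 -> degin e U w = m.-1 -> L1 z = L2 z ->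
  {in U, forall v, degin e U v = m -> L1 v = L2 v} -> L1 w = L2 w.
Proof.
have [n] := ubnP #|U|; elim: n U L1 L2 z => // n IHn U L1 L2 z; rewrite ltnS => leU.
move=> sUL cU kU Ld1 Ld2 nc1 nc2 zU wU dz dw eqz eqm.
have [D [sDU kD zD]] := kcoverP _ _ (subsetP kU z zU).
have [clD /eqP cD] := andP kD.
have z0 : degin e (U :\: D) z = 0.
  by move: dz; rewrite (degin_setID e z sDU) (kset_degin kD zD) -[RHS]addn0 => /addnI.
have cUz := clique_exit_conn cU clD sDU zD z0.
have subz L v : deg_lists e U L -> ~ colorable e U L -> v \in D -> (L z `<=` L v)%fset.
  move=> Ld nc vD; have [->|vz] := eqVneq v z; first exact: fsubset_refl.
  apply: (@noncut_sublist _ _ e_sym e_irr U) => //; first exact: (subsetP sDU).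
  by apply: (cliqueP _ _ clD); rewrite // eq_sym.
have tight L := @tight_lists _ _ e_sym e_irr U L cU.
(* Inside [D], the list of [z] is contained in all others, because [z] is not a cut vertex; as sizes
   agree, it equals the list of [w]. *)
have [wD|wD] := boolP (w \in D).
  have sub L : deg_lists e U L -> ~ colorable e U L -> L z = L w.
    move=> Ld nc; apply/eqP; rewrite eqEfcard subz //.
    by rewrite (tight L Ld nc w wU) (tight L Ld nc z zU) dz dw leqnn.
  by rewrite -(sub L1) // eqz (sub L2).
have clS : closed_in e (U :\: D) (U :\: D) by apply/closed_inP.
have wUD : w \in U :\: D by rewrite inE wD.
have [C [clC sC wC cC]] := component e_sym clS wUD.
have [_ HC] := closed_inP _ _ _ clC.
have CU : C \subset U by apply: subset_trans sC (subsetDl _ _).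
have zC : z \notin C by apply: contraL zD => /(subsetP sC)/setDP[].
have [||u' [u [u'C uU uC eu'u]]] := conn_exit cU CU.
- by apply/set0Pn; exists w.
- by apply: contraNneq zC => ->.
have uD : u \in D.
  by apply: contraR uC => uD; apply: (HC u') => //; rewrite inE uD.
have euu' : e u u' by rewrite e_sym.
have u'U := subsetP CU u' u'C.
have kC : C \subset kcover C.
  apply/subsetP => v vC; have vU := subsetP CU v vC.
  have [D' [sD' kD' vD']] := kcoverP _ _ (subsetP kU v vU).
  have [clD' _] := andP kD'.
  apply/kcoverP; exists D'; split=> //.
  apply: (conn_clique_sub clD' _ clC); last by apply/set0Pn; exists v; rewrite inE vC.
  apply/subsetP => t tD'; rewrite inE (subsetP sD') // andbT; apply/negP => tD.
  have eqD : D = D' by apply: (@kset_meet D D' t); rewrite // (subset_trans _ sUL).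
  by have /setDP[_] := subsetP sC v vC; rewrite eqD vD'.
(* The link between [u] and [u'] gives both of them the full degree [m] in [U], so [L1] and [L2]
   agree there; [u'] takes the role of [z] in [C]. *)
have du : degin e U u = m.
  apply/eqP; rewrite eqn_leq low_degin //=.
  have u'UD : u' \in U :\: D by apply: (subsetP sC).
  have := degin_gt0 u'UD euu'; rewrite (degin_setID e u sDU) (kset_degin kD uD).
  by move: m_ge5; clear; lia.
have dCu' : degin e C u' = m.-1.
  have := kcover_degin (subsetP kC u' u'C).
  have := low_degin sUL u'U; have := degin_exit CU uU uC eu'u.
  by move: m_ge5; clear; lia.
have du' : degin e U u' = m.
  have := low_degin sUL u'U; have := degin_exit CU uU uC eu'u.
  by rewrite dCu'; move: m_ge5; clear; lia.
(* Bad lists are exactly as large as the degrees, [m] at [u] and [m - 1] at [z], so [u] has a color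
   that [z] lacks. *)
have /fset0Pn[a] : (L1 u `\` L1 z != fset0)%fset.
  rewrite -cardfs_gt0 cardfsD subn_gt0.
  apply: leq_ltn_trans (fsubset_leq_card (fsubsetIr _ _)) _.
  rewrite (tight L1 Ld1 nc1 z zU) (tight L1 Ld1 nc1 u uU) dz du.
  by move: m_ge5; clear; lia.
rewrite inE => /andP[aLz aLu].
pose LC L v : {fset nat} := if v == u' then (L v `\ a)%fset else L v.
have wu' : w != u'.
  by apply/eqP => wu; move: dw; rewrite wu du'; move: m_ge5; clear; lia.
have LCd L : deg_lists e U L -> deg_lists e C (LC L).
  move=> Ld v vC; have vU := subsetP CU v vC; rewrite /LC.
  have [->|vu'] := eqVneq v u'; last by apply: leq_trans (Ld v vU); apply: degin_sub.
  have := degin_exit CU uU uC eu'u; have := Ld u' u'U.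
  by rewrite (cardfsD1 a (L u')); case: (a \in L u'); clear; lia.
have eqLC v : v \in C -> L1 v = L2 v -> LC L1 v = LC L2 v by rewrite /LC => _ ->.
have : LC L1 w = LC L2 w.
  apply: (IHn C _ _ u') => //.
  - apply: leq_trans leU; apply: proper_card; apply/properP; split=> //.
    by exists z.
  - exact: subset_trans sUL.
  - exact: LCd.
  - exact: LCd.
  - exact: (uncolorable_branch sUL cU Ld1 nc1 kD sDU zD uD u'C euu' clC aLu aLz).
  - apply: (uncolorable_branch sUL cU Ld2 nc2 kD sDU zD uD u'C euu' clC).
      by rewrite -eqm.
    by rewrite -eqz.
  - have := kcover_degin (subsetP kC w wC); have := degin_sub e w CU.
    by rewrite dw; clear; lia.
  - by apply: eqLC => //; apply: eqm.
  - move=> v vC dv; apply: eqLC => //; apply: eqm; first exact: (subsetP CU).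
    apply/eqP; rewrite eqn_leq low_degin ?(subsetP CU) //= -[X in X <= _]dv.
    exact: degin_sub.
by rewrite /LC (negPf wu').
Qed.

End LowGraph.

(** * Clusters and mid vertices *)

Section CriticalGraph.

Variables (T : finType) (e : rel T).
Hypotheses (e_sym : symmetric e) (e_irr : irreflexive e).
Implicit Types (A B C D F S U Y : {set T}) (x y z v : T) (L : T -> {fset nat}).
Implicit Types UU : {set {set T}}.

(* [m] is [k - 1]. *)
Variables (m : nat) (V : {set T}).
Hypothesis m_ge5 : 4 < m.
Hypothesis crit : forall F, F \subset V -> F != set0 -> exists2 L,
  {in F, forall v, m + degin e F v <= #|` L v| + degin e V v} & ~ colorable e F L.
Hypothesis no_clique : forall D, D \subset V -> clique e D -> #|D| <= m.

Definition low := [set v in V | degin e V v == m].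
Definition mid := [set v in V | degin e V v == m.+1].

Lemma low_sub : low \subset V.
Proof. by apply/subsetP => v; rewrite inE => /andP[]. Qed.

Lemma low_degV v : v \in low -> degin e V v = m.
Proof. by rewrite inE => /andP[_ /eqP]. Qed.

Lemma mid_sub : mid \subset V.
Proof. by apply/subsetP => v; rewrite inE => /andP[]. Qed.

Lemma mid_degV v : v \in mid -> degin e V v = m.+1.
Proof. by rewrite inE => /andP[_ /eqP]. Qed.

Lemma low_mid v : v \in low -> v \notin mid.
Proof. by move=> /low_degV dv; apply/negP => /mid_degV; rewrite dv; clear; lia. Qed.

Lemma low_uncolorable B : B \subset low -> B != set0 ->
  exists2 L, deg_lists e B L & ~ colorable e B L.
Proof.
move=> sB B0; have [L H nc] := crit (subset_trans sB low_sub) B0.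
exists L => // v vB; have := H v vB; rewrite low_degV ?(subsetP sB) //; clear; lia.
Qed.

Lemma low_degin_low : {in low, forall v, degin e low v <= m}.
Proof. by move=> v vL; rewrite -(low_degV vL); apply: degin_sub low_sub. Qed.

Lemma low_no_clique D : D \subset low -> clique e D -> #|D| <= m.
Proof. by move=> sD; apply: no_clique; apply: subset_trans sD low_sub. Qed.

Local Notation kcover := (kcover e m).
Local Notation kset := (kset e m).
Local Notation exits := (exits e m).
Local Notation degsum := (degsum e).

Definition cluster U := [&& U \subset low, conn e U & U \subset kcover U].

Lemma clusterP U : cluster U -> [/\ U \subset low, conn e U & U \subset kcover U].
Proof. by case/and3P. Qed.

Definition separated UU := {in UU &, forall U U', U != U' ->
  forall x y, x \in U -> y \in U' -> x != y /\ ~~ e x y}.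

Lemma glue_colorings UU L : separated UU -> {in UU, forall U, colorable e U L} ->
  colorable e (cover UU) L.
Proof.
move=> sep col.
have [f Hf] : exists f : {set T} -> T -> nat, forall U, U \in UU ->
    proper_on e U (f U) /\ {in U, forall x, f U x \in L x}.
  apply: (@fin_all_exists _ (fun=> T -> nat) (fun U c => U \in UU ->
    proper_on e U c /\ {in U, forall x, c x \in L x})) => U.
  have [UUU|] := boolP (U \in UU); last by exists (fun=> 0).
  by have [c pc cL] := col U UUU; exists c.
have triv : trivIset UU.
  apply/trivIsetP => U U' UU1 UU2 neq; apply/pred0P => x /=; apply/negP => /andP[xU xU'].
  by have [] := sep U U' UU1 UU2 neq x x xU xU'; rewrite eqxx.
exists (fun x => f (pblock UU x) x) => [x y xC yC exy|x xC].
  have xB := pblock_mem xC; have yB := pblock_mem yC.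
  have xP : x \in pblock UU x by rewrite mem_pblock.
  have yP : y \in pblock UU y by rewrite mem_pblock.
  have [eqB|neq] := eqVneq (pblock UU x) (pblock UU y).
    rewrite eqB; have [pc _] := Hf _ yB; apply: pc => //.
    by rewrite -eqB.
  by have [_] := sep _ _ xB yB neq x y xP yP; rewrite exy.
by have [_] := Hf _ (pblock_mem xC); apply; rewrite mem_pblock.
Qed.

(* The cluster [U] picks [yy U] through the edge to [ww U]; the list of [zz U] is
   known when [yy U] gets its color. *)
Section Reducible.

Variables (Y : {set T}) (UU : {set {set T}}) (yy ww zz : {set T} -> T).
Hypothesis Y0 : Y != set0.
Hypothesis YM : Y \subset mid.
Hypothesis clU : {in UU, forall U, cluster U}.
Hypothesis sepU : separated UU.
Hypothesis yyY : {in UU, forall U, yy U \in Y}.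
Hypothesis wwU : {in UU, forall U, ww U \in U /\ e (yy U) (ww U)}.
Hypothesis zzU : {in UU, forall U, zz U \in U /\ degin e U (zz U) = m.-1}.
Hypothesis zz_before : {in UU, forall U, forall y, y \in Y -> e (zz U) y ->
  enum_rank y < enum_rank (yy U)}.
Hypothesis picks : {in Y, forall y, #|[set U in UU | yy U == y]| + 2 <= degin e (cover UU) y}.

Let F := Y :|: cover UU.

Lemma disjoint_cluster U : cluster U -> [disjoint U & Y].
Proof.
case/clusterP => sU _ _; apply/pred0P => v /=; apply/negP => /andP[vU vY].
by have := low_mid (subsetP sU v vU); rewrite (subsetP YM).
Qed.

Lemma cluster_cover U : U \in UU -> U \subset cover UU.
Proof. by move=> UUU; apply: bigcup_sup. Qed.

Lemma cover_low : cover UU \subset low.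
Proof. by apply/bigcupsP => U /clU/clusterP[]. Qed.

Lemma disjoint_cover : [disjoint Y & cover UU].
Proof.
apply/pred0P => v /=; apply/negP => /andP[/(subsetP YM) vM /(subsetP cover_low) vL].
by have := low_mid vL; rewrite vM.
Qed.

Variable L : T -> {fset nat}.
Hypothesis Ld : {in F, forall v, m + degin e F v <= #|` L v| + degin e V v}.

Lemma cluster_degin_Y U v : U \in UU -> v \in U -> degin e U v + degin e Y v <= m.
Proof.
move=> UUU vU; have cU := clU UUU; have [sU _ _] := clusterP cU.
rewrite -(degin_disj _ _ (disjoint_cluster cU)) -(low_degV (subsetP sU v vU)).
apply: degin_sub; rewrite subUset (subset_trans sU low_sub).
exact: subset_trans YM mid_sub.
Qed.

Lemma cluster_list U v : U \in UU -> v \in U -> degin e U v + degin e Y v <= #|` L v|.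
Proof.
move=> UUU vU; have cU := clU UUU; have [sU _ _] := clusterP cU.
have vF : v \in F by rewrite inE (subsetP (cluster_cover UUU)) // orbT.
have := Ld vF; rewrite (low_degV (subsetP sU v vU)) addnC leq_add2r.
apply: leq_trans; rewrite -(degin_disj _ _ (disjoint_cluster cU)).
by apply: degin_sub; rewrite setUC setUS // cluster_cover.
Qed.

Lemma avail_deg_lists U c : U \in UU -> deg_lists e U (avail e Y c L).
Proof.
move=> UUU v vU; have := cluster_list UUU vU; have := card_avail e Y c L v.
by clear; lia.
Qed.

Lemma avail_agree c1 c2 v : (forall u, u \in Y -> e v u -> c1 u = c2 u) ->
  avail e Y c1 L v = avail e Y c2 L v.
Proof.
move=> H; apply/fsetP => a; apply/availP/availP => -[aL Ha]; split=> // u uY evu.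
  by rewrite -H // Ha.
by rewrite H // Ha.
Qed.

(** The earlier vertices of [Y] determine the colors left at [zz U], and vertices of degree [m] in
    [U] have no neighbor in [Y]. So [forced_list] fixes the colors left at [ww U], which lost just
    the color of [yy U], its only neighbor in [Y]. *)
Lemma bad_color_unique U c1 c2 : U \in UU ->
  (forall u, u \in Y -> enum_rank u < enum_rank (yy U) -> c1 u = c2 u) ->
  ~ colorable e U (avail e Y c1 L) -> ~ colorable e U (avail e Y c2 L) ->
  c1 (yy U) = c2 (yy U).
Proof.
move=> UUU agree nc1 nc2; have [sU cU kU] := clusterP (clU UUU).
have [wU eyw] := wwU UUU; have [zU dz] := zzU UUU; have yY := yyY UUU.
set y := yy U in agree eyw yY *; set w := ww U in wU eyw; set z := zz U in zU dz.
have ewy : e w y by rewrite e_sym.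
have dYw : 0 < degin e Y w := degin_gt0 yY ewy.
have dw : degin e U w = m.-1 /\ degin e Y w = 1.
  have := kcover_degin e_irr (subsetP kU w wU); have := cluster_degin_Y UUU wU.
  by move: dYw m_ge5; clear; lia.
have eqL : avail e Y c1 L w = avail e Y c2 L w.
  apply: (forced_list e_sym e_irr m_ge5 low_uncolorable low_degin_low low_no_clique
    sU cU kU (avail_deg_lists c1 UUU) (avail_deg_lists c2 UUU) nc1 nc2 zU wU) => //.
  - by case: dw.
  - by apply: avail_agree => u uY ezu; apply: agree => //; apply: zz_before.
  - move=> v vU dv; apply: avail_agree => u uY evu.
    have := cluster_degin_Y UUU vU; have := degin_gt0 uY evu.
    by rewrite dv; clear; lia.
have cw : #|` avail e Y c1 L w| = m.-1.
  by rewrite (tight_lists e_sym e_irr cU (avail_deg_lists c1 UUU) nc1 wU); case: dw.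
have c1L : c1 y \in L w.
  apply/negPn/negP => /(card_avail_missed yY ewy); rewrite cw.
  have := cluster_list UUU wU; case: dw => -> ->; clear; lia.
apply/eqP/negPn/negP => neq.
have : c1 y \in avail e Y c2 L w.
  apply/availP; split=> // u uY ewu; have [->|uy] := eqVneq u y; first by rewrite eq_sym.
  case: dw => _; rewrite (degin_D1 e w yY) ewy (@degin_D1 _ e _ w u) ?ewu //.
  by rewrite in_setD1 uy.
rewrite -eqL => /availP[_ /(_ y yY ewy)].
by rewrite eqxx.
Qed.

(** The list of [y] may be one shorter than its degree in [F]. Of the two spare edges in [picks],
    one makes up for this and the other leaves a color to choose. *)
Lemma greedy_step y (c : T -> nat) (bad : {set T} -> nat) : y \in Y ->
  exists2 a, a \in L y & (forall u, u \in Y -> e y u -> c u != a) /\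
    (forall U, U \in UU -> yy U = y -> bad U != a).
Proof.
move=> yY; pose used := [fset bad U | U in [set U in UU | yy U == y]]%fset.
have /fset0Pn[a] : (avail e Y c L y `\` used != fset0)%fset.
  rewrite -cardfs_gt0 cardfsD subn_gt0.
  apply: leq_ltn_trans (fsubset_leq_card (fsubsetIr _ _)) _.
  apply: leq_ltn_trans (leq_imfset_card _ _ _) _; rewrite -cardE.
  have yF : y \in F by rewrite inE yY.
  have := Ld yF; rewrite (mid_degV (subsetP YM y yY)) (degin_disj _ _ disjoint_cover).
  have arith a b c' d p : m + (b + d) <= a + m.+1 -> p + 2 <= d -> a <= c' + b -> p < c'.
    by clear; lia.
  by move/arith/(_ (picks yY)); apply; apply: card_avail.
rewrite in_fsetD => /andP[aused /availP[aL Ha]]; exists a => //; split=> // U UUU yU.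
apply: contraNneq aused => <-; apply/imfsetP; exists U => //=.
by rewrite inE UUU yU eqxx.
Qed.

(** [Y] is colored in the order of [enum_rank]. Invariant: a cluster whose picked vertex has its
    color stays colorable however the later vertices of [Y] are colored. *)
Lemma color_Y : exists c : T -> nat,
  [/\ proper_on e Y c, {in Y, forall x, c x \in L x}
    & {in UU, forall U, colorable e U (avail e Y c L)}].
Proof.
pose Yn n := [set y in Y | enum_rank y < n].
suff H n : exists c : T -> nat, [/\ proper_on e (Yn n) c, {in Yn n, forall x, c x \in L x}
    & forall U, U \in UU -> yy U \in Yn n -> forall c', {in Yn n, c' =1 c} ->
      colorable e U (avail e Y c' L)].
  have [c [pc cL cU]] := H #|T|; have eqY : Yn #|T| = Y.
    by apply/setP => y; rewrite inE ltn_ord andbT.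
  rewrite eqY in pc cL cU; exists c; split=> // U UUU.
  by apply: cU => //; apply: yyY.
elim: n => [|n [c [pc cL cU]]].
  have Y00 : Yn 0 = set0 by apply/setP => y; rewrite !inE ltn0 andbF.
  by exists (fun=> 0); split=> [x y|x|U _]; rewrite Y00 inE.
have YnS y : y \in Yn n.+1 -> y \notin Yn n -> y \in Y /\ enum_rank y = n :> nat.
  rewrite !inE => /andP[-> /=]; rewrite -leqNgt => le1 le2; split=> //.
  by move: le1 le2; clear; lia.
have [/exists_inP[y yY /eqP ry]|no] := boolP [exists y in Y, (enum_rank y == n :> nat)]; last first.
  suff -> : Yn n.+1 = Yn n by exists c.
  apply/setP => y; apply/idP/idP => [yn|]; last first.
    by rewrite !inE => /andP[-> /= /leqW].
  apply: contraNT no => /(YnS y yn)[yY ry].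
  by apply/exists_inP; exists y; rewrite ?ry.
(* [bad U] is the one color at [y] for which some continuation leaves [U] uncolorable; 0 is a dummy
   value when there is none or [U] did not pick [y]. *)
have [bad Hbad] : exists bad : {set T} -> nat, forall U, U \in UU -> yy U = y ->
    forall c', {in Yn n, c' =1 c} -> ~ colorable e U (avail e Y c' L) -> c' y = bad U.
  apply: (@fin_all_exists _ (fun=> nat) (fun U b => U \in UU -> yy U = y ->
    forall c', {in Yn n, c' =1 c} -> ~ colorable e U (avail e Y c' L) -> c' y = b)) => U.
  have [[UUU yU]|no] := classic (U \in UU /\ yy U = y); last by exists 0 => UUU yU; case: no.
  have [[c0 agr nc0]|no] := classic (exists2 c0 : T -> nat, {in Yn n, c0 =1 c}
    & ~ colorable e U (avail e Y c0 L)); last first.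
    by exists 0 => _ _ c' agr nc; case: no; exists c'.
  exists (c0 y) => _ _ c' agr' nc'; rewrite -yU.
  apply: bad_color_unique => // u uY; rewrite yU ry => ru.
  by have uYn : u \in Yn n; [rewrite inE uY | rewrite agr ?agr'].
have [a aL [anb abad]] := greedy_step c bad yY.
have yn : y \notin Yn n by rewrite inE yY ry ltnn.
have inYn x : x \in Yn n.+1 -> x = y \/ x \in Yn n /\ x != y.
  move=> xn; have [xYn|xYn] := boolP (x \in Yn n).
    by right; split=> //; apply: contraNneq yn => <-.
  by left; have [_ rx] := YnS x xn xYn; apply: enum_rank_inj; apply: val_inj; rewrite /= rx ry.
exists (fun x => if x == y then a else c x); split.
- have pa x : x \in Yn n -> e y x -> c x != a.
    by move=> xn; apply: anb; move: xn; rewrite inE => /andP[].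
  move=> x x' /inYn[->|[xn /negPf xy]] /inYn[->|[x'n /negPf x'y]] exx'.
  + by rewrite e_irr in exx'.
  + by rewrite eqxx x'y eq_sym pa.
  + by rewrite eqxx xy pa // e_sym.
  + by rewrite xy x'y pc.
- by move=> x /inYn[->|[xn /negPf xy]]; rewrite ?eqxx // xy cL.
- move=> U UUU yUn c' agr.
  have agrn : {in Yn n, c' =1 c}.
    move=> x xn; rewrite agr; last first.
      by move: xn; rewrite !inE => /andP[-> /= /leqW].
    by case: eqP => // xy; rewrite -xy xn in yn.
  have [yU|[yUn' _]] := inYn _ yUn; last exact: cU.
  apply: NNPP => nc; have := abad U UUU yU; rewrite -(Hbad U UUU yU c' agrn nc) agr.
    by rewrite !eqxx.
  by rewrite -yU.
Qed.

End Reducible.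

(** By [crit] there are bad lists on [Y :|: cover UU], but [color_Y] colors [Y] so that each cluster
    can still be completed, and separated clusters do not interfere. *)
Lemma reducible Y UU yy ww zz : Y != set0 -> Y \subset mid ->
  {in UU, forall U, cluster U} -> separated UU ->
  {in UU, forall U, yy U \in Y} ->
  {in UU, forall U, ww U \in U /\ e (yy U) (ww U)} ->
  {in UU, forall U, zz U \in U /\ degin e U (zz U) = m.-1} ->
  {in UU, forall U y, y \in Y -> e (zz U) y -> enum_rank y < enum_rank (yy U)} ->
  {in Y, forall y, #|[set U in UU | yy U == y]| + 2 <= degin e (cover UU) y} ->
  False.
Proof.
move=> Y0 YM clU sepU yyY wwU zzU before picks.
have FV : Y :|: cover UU \subset V.
  rewrite subUset (subset_trans YM mid_sub).
  exact: subset_trans (cover_low clU) low_sub.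
have F0 : Y :|: cover UU != set0.
  by apply: contraNneq Y0 => F0; rewrite -subset0 -F0 subsetUl.
have [L Ld] := crit FV F0; apply.
have [c [pc cL cU]] := color_Y YM clU yyY wwU zzU before picks Ld.
apply: (@colorable_extend _ _ e_sym Y _ c) => //; first exact: subsetUl.
rewrite setDUl setDv set0U (setDidPl _); last by rewrite disjoint_sym disjoint_cover.
exact: glue_colorings.
Qed.

(** With three neighbors in [U], the vertex [y] alone with [U] as its only pick would be reducible:
    two edges are left besides the pick, and the list of [z] does not depend on [y]. *)
Lemma cluster_degin_mid_le2 y U z : y \in mid -> cluster U -> z \in U ->
  degin e U z = m.-1 -> ~~ e y z -> degin e U y <= 2.
Proof.
move=> yM cU zU dz eyz; rewrite leqNgt; apply/negP => gt2.
have /card_gt0P[w] : 0 < degin e U y by apply: leq_trans gt2.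
rewrite inE => /andP[wU eyw].
apply: (@reducible [set y] [set U] (fun=> y) (fun=> w) (fun=> z)).
- by apply/set0Pn; exists y; rewrite set11.
- by rewrite sub1set.
- by move=> _ /set1P->.
- by move=> U1 U2 /set1P-> /set1P->; rewrite eqxx.
- by move=> *; rewrite set11.
- by move=> _ /set1P->.
- by move=> _ /set1P->.
- by move=> _ _ _ /set1P->; rewrite e_sym (negPf eyz).
move=> _ /set1P->; rewrite /cover big_set1; apply: leq_trans gt2.
rewrite addnC; apply: (@leq_add 2 _ 2 1) => //.
rewrite -(cards1 U); apply: subset_leq_card; apply/subsetP => U'.
by rewrite inE => /andP[].
Qed.

Lemma kset_cluster D : D \subset low -> kset D -> cluster D.
Proof.
move=> sD kD; apply/and3P; split=> //; last exact: sub_kcover.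
by apply: clique_conn; case/andP: kD.
Qed.

(** If [y] were adjacent to all of [D], the two would form a clique on [m + 1] vertices; otherwise a
    non-neighbor in [D] serves as [z]. *)
Lemma kset_degin_mid y D : y \in mid -> D \subset low -> kset D -> degin e D y <= 2.
Proof.
move=> yM sD kD; have [clD /eqP cD] := andP kD.
have yD : y \notin D by apply/negP => /(subsetP sD)/low_mid; rewrite yM.
have [/exists_inP[z zD eyz]|no] := boolP [exists z in D, ~~ e y z].
  apply: (@cluster_degin_mid_le2 y D z) => //; first exact: kset_cluster.
  exact: kset_degin.
have adj z : z \in D -> e y z.
  by move=> zD; apply: contraNT no => eyz; apply/exists_inP; exists z.
suff : #|y |: D| <= m by rewrite cardsU1 yD cD add1n ltnn.
apply: no_clique.
  by rewrite subUset sub1set (subsetP mid_sub) //= (subset_trans sD) // low_sub.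
apply/cliqueP => a b /setU1P[->|aD] /setU1P[->|bD] neq.
- by rewrite eqxx in neq.
- exact: adj.
- by rewrite e_sym adj.
- exact: (cliqueP _ _ clD).
Qed.

(** An end block of [U] is a copy of [K_{k-1}] whose non-root vertices have degree [m - 1] in [U]. A
    non-neighbor of [y] among them serves as [z]; without one, [y] would have [m - 1] neighbors in
    this copy, more than [kset_degin_mid] allows. *)
Lemma cluster_degin_mid y U : y \in mid -> cluster U -> degin e U y <= 2.
Proof.
move=> yM cU; have [sU _ kU] := clusterP cU.
have [->|U0] := eqVneq U set0; first by rewrite degin_eq0 // => u; rewrite inE.
have [B [x [hB ncB [gtB|[eqB dx]]]]] := pick_end_block e_sym e_irr U0; last first.
  have [sBU xB _] := and3P hB.
  have := kcover_degin e_irr (subsetP kU x (subsetP sBU x xB)).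
  by rewrite dx; move: m_ge5; clear; lia.
have [sBU xB _] := and3P hB; have sB := subset_trans sBU sU.
have dB v : v \in B :\ x -> m.-1 <= degin e B v.
  move=> vB; have vU : v \in U by case/setD1P: vB => _ /(subsetP sBU).
  by rewrite -(hangs_degin hB vB); apply: kcover_degin => //; apply: (subsetP kU).
have cBx : #|B| = #|B :\ x|.+1 by rewrite (cardsD1 x B) xB.
have /card_gt0P[v vB] : 0 < #|B :\ x| by rewrite cBx in gtB.
have vB' : v \in B by case/setD1P: vB.
have [clB|reg] := low_block e_sym e_irr low_uncolorable sB ncB; last first.
  by have := dB v vB; rewrite reg //; move: m_ge5; clear; lia.
have kB : kset B.
  rewrite /kset clB eqn_leq low_no_clique //=.
  have := dB v vB; rewrite (degin_clique e_irr clB vB') cBx.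
  by move: m_ge5; clear; lia.
have [/exists_inP[z zB eyz]|no] := boolP [exists z in B :\ x, ~~ e y z].
  apply: (@cluster_degin_mid_le2 y U z) => //.
    by case/setD1P: zB => _ /(subsetP sBU).
  by rewrite (hangs_degin hB zB); apply: kset_degin => //; case/setD1P: zB.
have : #|B :\ x| <= degin e B y.
  apply/subset_leq_card/subsetP => z zB; rewrite inE; case/setD1P: (zB) => _ -> /=.
  by apply: contraNT no => eyz; apply/exists_inP; exists z.
have := kset_degin_mid yM sB kB; case/andP: kB => _; rewrite cBx => /eqP.
by move: m_ge5; clear; lia.
Qed.

(** * Counting the edges between clusters and mid vertices *)

Local Notation W := (kcover low).

Definition clusters := [set U : {set T} | [&& U != set0, closed_in e U W & conn e U]].

Lemma clustersP U : U \in clusters -> [/\ U != set0, closed_in e U W & conn e U].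
Proof. by rewrite inE => /and3P. Qed.

Lemma clusters_eq U U' x : U \in clusters -> U' \in clusters -> x \in U -> x \in U' -> U = U'.
Proof.
have sub A B : A \in clusters -> B \in clusters -> x \in A -> x \in B -> A \subset B.
  move=> /clustersP[_ /closed_inP[sA _] cA] /clustersP[_ /closed_inP[sB HB] _] xA xB.
  apply/setIidPl; move/connP: cA; apply; first by apply/set0Pn; exists x; rewrite inE xA.
  apply/closed_inP; split=> [|u v /setIP[uA uB] vA euv]; first exact: subsetIl.
  by rewrite inE vA (HB u) // (subsetP sA).
by move=> cU cU' xU xU'; apply/eqP; rewrite eqEsubset !sub.
Qed.

Lemma clusters_cluster U : U \in clusters -> cluster U.
Proof.
move=> /clustersP[U0 clU cU]; have [sU HU] := closed_inP _ _ _ clU.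
apply/and3P; split=> //; first exact: subset_trans sU (kcover_sub _ _ _).
apply/subsetP => v vU; have [D [sD kD vD]] := kcoverP _ _ _ _ (subsetP sU v vU).
apply/kcoverP; exists D; split=> //; have [clD _] := andP kD.
apply: (conn_clique_sub clD (sub_kcover sD kD) clU).
by apply/set0Pn; exists v; rewrite inE vU.
Qed.

Lemma clusters_separated UU : UU \subset clusters -> separated UU.
Proof.
move=> sUU U U' UUU UUU' neq x y xU yU'.
have cU := subsetP sUU U UUU; have cU' := subsetP sUU U' UUU'.
split; first by apply: contraNneq neq => xy; apply/eqP/(clusters_eq cU cU' xU); rewrite xy.
apply: contra neq => exy; apply/eqP/(clusters_eq cU cU' _ yU').
have [_ /closed_inP[_ HU] _] := clustersP cU.
have [_ /closed_inP[sU' _] _] := clustersP cU'.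
by apply: (HU x) => //; apply: (subsetP sU').
Qed.

Lemma clusters_cover w : w \in W -> exists2 U, U \in clusters & w \in U.
Proof.
move=> wW; have clW : closed_in e W W by apply/closed_inP.
have [U [clU _ wU cU]] := component e_sym clW wW.
by exists U => //; rewrite inE clU cU !andbT; apply/set0Pn; exists w.
Qed.

Lemma card_hit UU (R : {set T}) : UU \subset clusters ->
  {in UU, forall U, U :&: R != set0} -> #|UU| <= #|R|.
Proof.
move=> sUU hit.
have [f Hf] : exists f : {set T} -> option T, forall U, U \in UU ->
    exists2 r, f U = Some r & r \in U :&: R.
  apply: (@fin_all_exists _ (fun=> option T) (fun U o => U \in UU ->
    exists2 r, o = Some r & r \in U :&: R)) => U.
  have [UUU|] := boolP (U \in UU); last by exists None.
  by have /set0Pn[r rU] := hit U UUU; exists (Some r) => _; exists r.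
have finj : {in UU &, injective f}.
  move=> U U' UUU UUU' eqf; have [r fU /setIP[rU _]] := Hf U UUU.
  have [r' fU' /setIP[rU' _]] := Hf U' UUU'.
  move: rU'; have -> : r' = r by move: eqf; rewrite fU fU' => -[].
  by apply: (clusters_eq (x := r)) => //; apply: (subsetP sUU).
have someI : injective (@Some T) by move=> ? ? [].
rewrite -(card_in_imset finj) -(card_imset (mem R) someI).
apply/subset_leq_card/subsetP => _ /imsetP[U UUU ->].
have [r -> /setIP[_ rR]] := Hf U UUU; exact: imset_f.
Qed.

(* Three edges from one cluster cannot all go to the same mid vertex, so among three
   picks there is one whose mid vertex comes after that of another. *)
Definition quota U := if exits low U then 1 else 3.

Lemma quota_le (R P : {set T}) : reps e m low R P ->
  \sum_(U in clusters) quota U <= #|R| + 2 * #|P|.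
Proof.
move=> rRP; pose pure := [set U in clusters | ~~ exits low U].
have hR : #|clusters| <= #|R|.
  apply: card_hit => // U /clustersP[U0 clU _].
  by case/andP: (rRP U U0 clU).
have hP : #|pure| <= #|P|.
  apply: card_hit => [|U]; first by apply/subsetP => U; rewrite inE => /andP[].
  rewrite !inE => /andP[/and3P[U0 clU _] ex].
  by case/andP: (rRP U U0 clU) => _; rewrite (negPf ex) orbF.
have -> : \sum_(U in clusters) quota U = #|clusters| + 2 * #|pure|.
  rewrite -sum1_card mulnC -sum_nat_const (big_setID pure) /=.
  rewrite (setIidPr _); last by apply/subsetP => U; rewrite inE => /andP[].
  rewrite [X in _ = X + _](big_setID pure) /= (setIidPr _); last first.
    by apply/subsetP => U; rewrite inE => /andP[].
  rewrite addnAC -big_split /=; congr (_ + _); apply: eq_bigr => U.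
    by rewrite inE => /andP[_ /negPf ex]; rewrite /quota ex.
  by rewrite !inE negb_and negbK => /andP[/orP[/negPf->//|ex] _]; rewrite /quota ex.
by move: hR hP; clear; lia.
Qed.

Lemma low_mid_degin v : v \in low -> degin e low v + degin e mid v <= m.
Proof.
move=> vL; rewrite -degin_disj; last first.
  by apply/pred0P => u /=; apply/negP => /andP[/low_mid uM]; rewrite (negPf uM).
rewrite -[X in _ <= X](low_degV vL); apply: degin_sub.
by rewrite subUset low_sub mid_sub.
Qed.

Lemma kcover_degin_mid w : w \in W -> degin e mid w <= 1.
Proof.
move=> wW; have wL : w \in low by apply: subsetP wW; apply: kcover_sub.
have := low_mid_degin wL; have := kcover_degin e_irr wW.
by move: m_ge5; clear; lia.
Qed.

Lemma mid_unique w y y' : w \in W -> y \in mid -> y' \in mid -> e w y -> e w y' -> y = y'.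
Proof.
move=> wW yM y'M ewy ewy'; apply/eqP/negPn/negP => neq.
have := kcover_degin_mid wW; rewrite (degin_D1 e w yM) ewy (@degin_D1 _ e _ w y') ?ewy' //.
by rewrite in_setD1 eq_sym neq.
Qed.

Lemma cluster_unlinked U w t : U \in clusters -> w \in U -> t \in V -> t \notin U -> e w t ->
  degin e U w = m.-1.
Proof.
move=> cU wU tV tU ewt; have [sU _ kU] := clusterP (clusters_cluster cU).
have sUV : U \subset V by apply: subset_trans sU low_sub.
have := degin_exit sUV tV tU ewt; rewrite (low_degV (subsetP sU w wU)).
have := kcover_degin e_irr (subsetP kU w wU).
by move: m_ge5; clear; lia.
Qed.

(** A cluster vertex with a low neighbor outside all copies of [K_{k-1}] has used up its [m] edges,
    so no mid vertex affects its list. This is why [quota] is only 1 for such clusters. *)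
Lemma exits_known U : U \in clusters -> exits low U ->
  exists z, [/\ z \in U, degin e U z = m.-1 & forall y, y \in mid -> ~~ e z y].
Proof.
move=> cU /exists_inP[z zU /exists_inP[u /setDP[uL uW] ezu]].
have [sU cnU kU] := clusterP (clusters_cluster cU).
have uU : u \notin U.
  have [_ /closed_inP[sUW _] _] := clustersP cU.
  by apply: contra uW; apply: (subsetP sUW).
have dz : degin e U z = m.-1.
  by apply: (cluster_unlinked cU zU _ uU ezu); apply: (subsetP low_sub).
exists z; split=> // y yM; apply/negP => ezy.
have := low_mid_degin (subsetP sU z zU); have := degin_exit sU uL uU ezu.
by have := degin_gt0 yM ezy; rewrite dz; move: m_ge5; clear; lia.
Qed.

(** Otherwise the edges between mid vertices and clusters outnumber a demand of 2 per mid vertex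
    plus [quota] per cluster. Then [orientation] yields a part where each cluster owns enough edges
    to pick from and each mid vertex keeps two others, which [reducible] excludes. *)
Lemma mid_kcover_bound (R P : {set T}) : reps e m low R P ->
  degsum mid W <= 2 * #|mid| + (#|R| + 2 * #|P|).
Proof.
move=> rRP; apply: leq_trans (_ : 2 * #|mid| + \sum_(U in clusters) quota U <= _); last first.
  by rewrite leq_add2l quota_le.
rewrite leqNgt; apply/negP => big.
(* A vertex of [W] has at most one mid neighbor, so these edges are indexed by their ends in [W]. *)
pose E : finType := {w : T | (w \in W) && (0 < degin e mid w)}.
have EW (w : E) : val w \in W by case: w => w /= /andP[].
have [yof yofP] : exists f : E -> T, forall w, f w \in mid /\ e (val w) (f w).
  apply: (@fin_all_exists _ (fun=> T) (fun (w : E) y => y \in mid /\ e (val w) y)).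
  case=> w /= /andP[_ /card_gt0P[y]]; rewrite inE => /andP[yM ewy].
  by exists y.
have [uof uofP] : exists f : E -> {set T}, forall w, f w \in clusters /\ val w \in f w.
  apply: (@fin_all_exists _ (fun=> {set T}) (fun (w : E) U => U \in clusters /\ val w \in U)) => w.
  by have [U cU wU] := clusters_cover (EW w); exists U.
pose N : finType := (T + {set T})%type.
pose s (w : E) : N := inl (yof w).
pose t (w : E) : N := inr (uof w).
pose n (v : N) := match v with inl y => (y \in mid) * 2 | inr U => (U \in clusters) * quota U end.
have cardE : #|E| = degsum mid W.
  rewrite card_sig /degsum -sum1_card big_mkcond [RHS]big_mkcond /=; apply: eq_bigr => w _.
  rewrite inE; case wW: (w \in W) => //=; have := kcover_degin_mid wW.
  by case: (degin e mid w) => [|[|]].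
have sumn : \sum_v n v = 2 * #|mid| + \sum_(U in clusters) quota U.
  rewrite big_sumType /= mulnC -sum_nat_const; congr (_ + _); rewrite [RHS]big_mkcond;
  by apply: eq_bigr => i _; case: (i \in _); rewrite ?mul1n ?mul0n.
have [|X insX [g [gst gn]]] := @orientation E N s t n; first by rewrite sumn cardE.
pose ins (w : E) := (s w \in X) && (t w \in X).
pose Y := [set y in mid | inl y \in X].
pose UU := [set U in clusters | inr U \in X].
have YM : Y \subset mid by apply/subsetP => y; rewrite inE => /andP[].
have sUU : UU \subset clusters by apply/subsetP => U; rewrite inE => /andP[].
have insY w : ins w -> yof w \in Y.
  by move=> /andP[sX _]; rewrite inE sX andbT; have [] := yofP w.
have insU w : ins w -> uof w \in UU.
  by move=> /andP[_ tX]; rewrite inE tX andbT; have [] := uofP w.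
have gU U w : g w = inr U -> uof w = U by case: (gst w) => -> //; case.
have gY y w : g w = inl y -> yof w = y by case: (gst w) => -> //; case.
have quotaU U : U \in UU -> quota U <= #|[set w : E | ins w & g w == inr U]|.
  rewrite inE => /andP[cU UX]; have := gn _ UX; rewrite /n cU mul1n => le.
  apply: leq_trans le _; apply/subset_leq_card/subsetP => w.
  by rewrite !inE => /andP[/andP[sX tX] ->]; rewrite /ins sX tX.
(* The pair consists of the edge through which [U] picks and the vertex that serves as [zz U]. *)
have choose U : U \in UU -> exists p : E * T, [/\ ins p.1, g p.1 = inr U,
    p.2 \in U /\ degin e U p.2 = m.-1
    & forall y, y \in mid -> e p.2 y -> enum_rank y < enum_rank (yof p.1)].
  move=> UUU; have cU := subsetP sUU U UUU; have := quotaU U UUU; rewrite /quota.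
  case: ifP => [ex /card_gt0P[w]|_ gt2].
    rewrite inE => /andP[iw /eqP gw]; have [z [zU dz nz]] := exits_known cU ex.
    by exists (w, z); split=> //= y yM; rewrite (negPf (nz y yM)).
  set A := [set w | _] in gt2.
  have AP w : w \in A -> [/\ ins w, g w = inr U & val w \in U].
    rewrite inE => /andP[iw /eqP gw]; split=> //.
    by have [_] := uofP w; rewrite (gU _ _ gw).
  (* The three edges do not all lead to one mid vertex, by [cluster_degin_mid], so two of their mid
     ends have different ranks. [U] picks the later one, and the other edge ends in a vertex of [U]
     whose list is settled before. *)
  have [w1 [w2 [w1A w2A lt12]]] : exists w1 w2, [/\ w1 \in A, w2 \in A
      & enum_rank (yof w1) < enum_rank (yof w2)].
    have /card_gt0P[w0 w0A] : 0 < #|A| by apply: leq_trans gt2.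
    have [/forall_inP same|] := boolP [forall w in A, yof w == yof w0].
      suff : #|A| <= 2 by rewrite leqNgt gt2.
      have [yM _] := yofP w0.
      apply: leq_trans (cluster_degin_mid yM (clusters_cluster cU)).
      rewrite -(card_imset _ val_inj); apply/subset_leq_card/subsetP => _ /imsetP[w wA ->].
      have [_ _ wU] := AP w wA; rewrite inE wU e_sym -(eqP (same w wA)).
      by have [] := yofP w.
    rewrite negb_forall_in => /exists_inP[w wA neq].
    have [lt|lt|eqr] := ltngtP (enum_rank (yof w)) (enum_rank (yof w0)).
    - by exists w, w0.
    - by exists w0, w.
    by case/eqP: neq; apply/enum_rank_inj/val_inj.
  have [i1 g1 U1] := AP _ w1A; have [i2 g2 U2] := AP _ w2A.
  have [y1M e1] := yofP w1.
  exists (w2, val w1); split=> //=.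
    split=> //; apply: (cluster_unlinked cU U1 _ _ e1); first exact: (subsetP mid_sub).
    have [sU _ _] := clusterP (clusters_cluster cU).
    by apply/negP => /(subsetP sU)/low_mid; rewrite y1M.
  by move=> y yM e1y; rewrite (mid_unique (EW w1) yM y1M e1y e1).
have /card_gt0P[w0] := insX; rewrite inE => iw0.
have [p Hp] : exists p : {set T} -> E * T, forall U, U \in UU -> [/\ ins (p U).1, g (p U).1 = inr U,
    (p U).2 \in U /\ degin e U (p U).2 = m.-1
    & forall y, y \in mid -> e (p U).2 y -> enum_rank y < enum_rank (yof (p U).1)].
  apply: (@fin_all_exists _ (fun=> (E * T)%type) (fun U q => U \in UU -> [/\ ins q.1, g q.1 = inr U,
    q.2 \in U /\ degin e U q.2 = m.-1
    & forall y, y \in mid -> e q.2 y -> enum_rank y < enum_rank (yof q.1)])) => U.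
  have [/choose[q Hq]|] := boolP (U \in UU); first by exists q.
  by exists (w0, yof w0).
apply: (@reducible Y UU (fun U => yof (p U).1) (fun U => val (p U).1) (fun U => (p U).2)) => //.
- by apply/set0Pn; exists (yof w0); apply: insY.
- by move=> U /(subsetP sUU)/clusters_cluster.
- exact: clusters_separated.
- by move=> U /Hp[/insY].
- move=> U UUU; have [_ gp _ _] := Hp U UUU; have [_] := uofP (p U).1.
  by rewrite (gU _ _ gp) e_sym; have [] := yofP (p U).1.
- by move=> U /Hp[].
- by move=> U /Hp[_ _ _ H] y /(subsetP YM); apply: H.
move=> y yY; have yM := subsetP YM y yY.
(* Edges kept by [y] and edges through which [y] is picked are distinct, because [g] assigns each
   edge to one end. *)
pose A1 := [set w : E | ins w & g w == inl y].
pose A2 := [set (p U).1 | U in [set U in UU | yof (p U).1 == y]].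
have c1 : 2 <= #|A1|.
  have yX : inl y \in X by move: yY; rewrite inE => /andP[].
  have := gn _ yX; rewrite /n yM => le.
  apply: leq_trans le _; apply/subset_leq_card/subsetP => w.
  by rewrite !inE => /andP[/andP[sX tX] ->]; rewrite /ins sX tX.
have c2 : #|A2| = #|[set U in UU | yof (p U).1 == y]|.
  apply: card_in_imset => U U' /setIdP[UUU _] /setIdP[UUU' _] eqp.
  have [_ gp _ _] := Hp U UUU; have [_ gp' _ _] := Hp U' UUU'.
  by move: gp; rewrite eqp gp' => -[].
have dis : A1 :&: A2 = set0.
  apply/setP => w; rewrite in_setI in_set0; apply/negP => /andP[].
  rewrite inE => /andP[_ /eqP gw] /imsetP[U]; rewrite inE => /andP[UUU _] eqw.
  by have [_ gp _ _] := Hp U UUU; rewrite eqw gp in gw.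
rewrite -c2 addnC; apply: leq_trans (_ : #|A1 :|: A2| <= _).
  by rewrite cardsU dis cards0 subn0 leq_add2r.
rewrite -(card_imset _ val_inj); apply/subset_leq_card/subsetP => _ /imsetP[w wA ->].
have [iw yw] : ins w /\ yof w = y.
  case/setUP: wA => [|/imsetP[U]]; first by rewrite inE => /andP[iw /eqP/gY].
  by rewrite inE => /andP[/Hp[iw _ _ _] /eqP yw] ->.
rewrite inE e_sym -yw; have [_ ->] := yofP w; rewrite andbT.
by have [_ wU] := uofP w; apply/bigcupP; exists (uof w); rewrite ?insU.
Qed.

(** * Degree sums over low, mid and high vertices *)

(** A single vertex is uncolorable only with an empty list, which by [crit] excludes a smaller
    degree. *)
Lemma min_degree v : v \in V -> m <= degin e V v.
Proof.
move=> vV; have [||L Ld nc] := crit (F := [set v]); rewrite ?sub1set //.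
  by apply/set0Pn; exists v; rewrite set11.
have := Ld v (set11 v); rewrite degin1 e_irr addn0.
suff -> : #|` L v| = 0 by rewrite add0n.
apply/eqP; rewrite cardfs_eq0; apply/eqP/fsetP => a; rewrite inE; apply/negP => aL.
apply: nc; exists (fun=> a) => [x y /set1P-> /set1P->|x /set1P->//].
by rewrite e_irr.
Qed.

Definition high := V :\: (low :|: mid).

Lemma degsum_V A : degsum V A = degsum low A + degsum mid A + degsum high A.
Proof.
have s : low :|: mid \subset V by rewrite subUset low_sub mid_sub.
rewrite (degsum_setIDl _ _ s); congr (_ + _).
rewrite (@degsum_setIDl _ e low) ?subsetUl // setDUl setDv set0U; congr (_ + degsum _ _).
by apply/setDidPl/pred0P => v /=; apply/negP => /andP[vM /low_mid]; rewrite vM.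
Qed.

Lemma degsum_high : m.+2 * #|high| <= degsum V high.
Proof.
rewrite mulnC -sum_nat_const; apply: leq_sum => v /setDP[vV].
rewrite in_setU !inE vV /= => /norP[n1 n2].
by have := min_degree vV; move: n1 n2; clear; lia.
Qed.

Lemma degsum_mono A B S : A \subset B -> degsum A S <= degsum B S.
Proof. by move=> sAB; apply: leq_sum => v _; apply: degin_sub. Qed.

(** The cluster costs in [low_weight], used with no marks, cancel against those in
    [mid_kcover_bound]. What remains are edges from mid and high vertices, bounded by their
    degrees. *)
Lemma low_count (kap h : rat) : (1 <= kap -> kap <= 2 -> 1 <= h -> h <= 2 ->
  (1 + h) * (m%:R - 2) = kap * m%:R -> (m%:R - 1) * (2 - kap) = 2 + h ->
  kap * #|low|%:R <= (m.+1 * #|mid| + degsum V high)%:R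
    + h * (2 * #|mid| + degsum V high)%:R)%R.
Proof.
move=> k1 k2 h1 h2 b1 b2.
have [R [P [rRP]]] :=
  low_weight e_sym e_irr m_ge5 low_uncolorable low_degin_low low_no_clique
    k1 k2 h1 h2 b1 b2 erefl (subxx low) (sub0set low)
  (fun v vM => ltac:(by rewrite inE in vM)).
have := mid_kcover_bound rRP; rewrite /phi cards0 mulr0 addr0.
have lowE A : A \subset low -> degsum V A = (#|A| * m)%N.
  by move=> sA; apply: degsum_const => v vA; apply: low_degV; apply: (subsetP sA).
have EL := lowE low (subxx low); have EW := lowE W (kcover_sub _ _ _).
rewrite degsum_V in EL; rewrite degsum_V in EW.
have leM : degsum mid low <= m.+1 * #|mid|.
  rewrite (degsumC e_sym) mulnC -(@degsum_const _ e mid V m.+1) ?degsum_mono ?low_sub //.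
  by move=> v /mid_degV.
have leH : degsum high low <= degsum V high by rewrite (degsumC e_sym) degsum_mono ?low_sub.
have leHW : degsum high W <= degsum V high.
  by rewrite (degsumC e_sym) degsum_mono // (subset_trans (kcover_sub _ _ _)) ?low_sub.
move: EL EW leM leH leHW.
move: (degsum low low) (degsum mid low) (degsum high low) => a1 a2 a3.
move: (degsum low W) (degsum mid W) (degsum high W) => c1 c2 c3.
move: (degsum V high) => Z; clear -h1 => EL EW leM leH leHW bnd.
have h0 : (0 <= h)%R by apply: le_trans h1.
have A1 : (a1%:R = #|low|%:R * m%:R - a2%:R - a3%:R :> rat)%R.
  by rewrite -natrM -EL !natrD; ring.
have A2 : (m%:R * #|W|%:R - c1%:R <= (2 * #|mid| + (#|R| + 2 * #|P|))%:R + Z%:R :> rat)%R.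
  rewrite mulrC -natrM -EW !natrD; move: bnd leHW; rewrite -!(ler_nat rat) !natrD.
  lra.
have A3 := ler_wpM2l h0 A2.
move: leM leH; rewrite -!(ler_nat rat) => B1 B2 C.
move: A3 C; rewrite A1 !(natrD _ _ Z) (natrD _ (2 * #|mid|)).
lra.
Qed.

Lemma degree_sum_bound (x : rat) : (x = m%:R + 1 ->
  (m%:R + (2 * x - 5) * (x - 3) / (x ^+ 3 - 12 * x + 15)) * #|V|%:R
    <= (degsum V V)%:R)%R.
Proof.
move=> xE; have x6 : (6 <= x)%R.
  by rewrite xE -(natrD _ m 1) (ler_nat _ 6) addn1.
have mE : (m%:R = x - 1 :> rat)%R by rewrite xE; ring.
have sV : low :|: mid \subset V by rewrite subUset low_sub mid_sub.
have dis : low :&: mid = set0.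
  by apply/setP => v; rewrite in_setI in_set0; apply/negP => /andP[/low_mid/negPf->].
have cV : #|V| = #|low| + #|mid| + #|high|.
  rewrite -(cardsID (low :|: mid) V) (setIidPr sV); congr (_ + _).
  by rewrite cardsU dis cards0 subn0.
have dV : degsum V V = m * #|low| + m.+1 * #|mid| + degsum V high.
  rewrite (degsum_setIDr e_sym _ sV); congr (_ + _).
  rewrite (@degsum_setIDr _ _ e_sym low) ?subsetUl //; congr (_ + _).
    by rewrite mulnC; apply: degsum_const => v /low_degV.
  rewrite setDUl setDv set0U (setDidPl _).
    by rewrite mulnC; apply: degsum_const => v /mid_degV.
  by rewrite -setI_eq0 setIC dis.
(* These values of [kap] and [h] solve the two balance equations for [m = x - 1]. *)
have count := @low_count ((2 * x - 5) * (x - 3) / (x ^+ 2 - 4 * x + 5))%R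
  (x * (x - 3) / (x ^+ 2 - 4 * x + 5))%R.
move: degsum_high count; rewrite cV dV mE.
rewrite -(ler_nat rat) !natrD !natrM mE.
move: (#|low|%:R : rat)%R (#|mid|%:R : rat)%R (#|high|%:R : rat)%R ((degsum V high)%:R : rat)%R
  (ler0n rat #|high|) => l y hh Z hh0 hZ count.
have Q0 : (0 < x ^+ 2 - 4 * x + 5)%R by nra.
have D0 : (0 < x ^+ 3 - 12 * x + 15)%R by nra.
have {}count : ((2 * x - 5) * (x - 3) * l <=
    (x ^+ 2 - 4 * x + 5) * (x * y + Z) + x * (x - 3) * (2 * y + Z))%R.
  have Qn0 : (x ^+ 2 - 4 * x + 5 != 0)%R by rewrite gt_eqF.
  have : ((2 * x - 5) * (x - 3) / (x ^+ 2 - 4 * x + 5) * l <= x * y + Z +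
      x * (x - 3) / (x ^+ 2 - 4 * x + 5) * (2 * y + Z))%R.
    rewrite (_ : x * y = y + (x - 1) * y)%R; last by ring.
    rewrite (_ : 2 * y = y + (y + 0))%R; last by ring.
    apply: count; rewrite ?ler_pdivlMr ?ler_pdivrMr //; try nra; by field.
  rewrite -(ler_pM2l Q0) => H; apply: le_trans (le_trans _ H) _;
    by rewrite le_eqVlt; apply/orP; left; apply/eqP; field.
have c0 : (0 <= (x - 2) * (x ^+ 2 - 5))%R by rewrite mulr_ge0 //; nra.
have t1 : (0 <= (x - 2) * (x ^+ 2 - 5) * (Z - (x + 1) * hh))%R.
  by rewrite mulr_ge0 // subr_ge0; move: hZ; lra.
have t2 : (0 <= hh * ((3 * x - 5) * (x - 2)))%R.
  by rewrite !mulr_ge0 //; lra.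
(* This is the sum of [count], [t1] and [t2]. The denominator [x ^+ 3 - 12 * x + 15] makes the terms
   in [y] match exactly; the surplus in [Z] pays for the high vertices, whose degrees are at least
   [x + 1]. *)
have key : ((2 * x - 5) * (x - 3) * (l + y + hh) <=
    (y + Z - (x - 1) * hh) * (x ^+ 3 - 12 * x + 15))%R by lra.
have -> : ((x - 1 + (2 * x - 5) * (x - 3) / (x ^+ 3 - 12 * x + 15)) * (l + y + hh) =
  (x - 1) * (l + y + hh) + (2 * x - 5) * (x - 3) * (l + y + hh) / (x ^+ 3 - 12 * x + 15))%R.
  by ring.
by move: key; rewrite -ler_pdivrMr // => key; lra.
Qed.

End CriticalGraph.

(** * From list-critical graphs to the setting of vertex sets *)

Section CriticalSgraph.

Variables (T : finType) (G : sgraph T).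
Implicit Types (A D E F : {set T}) (L : T -> {fset nat}).
Local Notation e := (adjacent G).
Local Notation V := (vertices G).

Lemma edgesP E : E \in edges G -> E \subset V /\ #|E| = 2.
Proof. by move=> EG; have /forall_inP/(_ E EG)/andP[? /eqP] := edges_wf G. Qed.

Lemma adjacent_sym : symmetric e.
Proof. by move=> x y; rewrite /adjacent setUC. Qed.

Lemma adjacent_irr : irreflexive e.
Proof.
move=> x; apply/negP => /edgesP[_]; rewrite setUid cards1.
by [].
Qed.

Lemma adjacent_vertices x y : e x y -> x \in V /\ y \in V.
Proof. by move/edgesP => [/subsetP sV _]; split; apply: sV; rewrite !inE eqxx ?orbT. Qed.

Lemma degsum_edges : degsum e V V = 2 * #|edges G|.
Proof.
have deg v : v \in V -> degin e V v = \sum_(E in edges G) (v \in E).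
  move=> vV; rewrite -big_mkcondr /= sum1_card.
  pose f u : {set T} := [set v; u].
  have finj : {in [set u in V | e v u] &, injective f}.
    move=> u u'; rewrite !inE => /andP[_ evu] _ /setP/(_ u).
    rewrite !inE eqxx orbT => /esym/orP[/eqP uv|/eqP//].
    by rewrite uv adjacent_irr in evu.
  rewrite /degin -(card_in_imset finj); apply: eq_card => E.
  apply/imsetP/idP => [[u]|].
    by rewrite inE => /andP[_ evu] ->; rewrite unfold_in /= -/(e v u) evu !inE eqxx.
  rewrite unfold_in /= => /andP[EG vE]; have [sE /eqP/cards2P[a [b [ab eqE]]]] := edgesP EG.
  have: v \in [set a; b] by rewrite -eqE.
  have aE : a \in E by rewrite eqE !inE eqxx.
  have bE : b \in E by rewrite eqE !inE eqxx orbT.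
  rewrite !inE => /orP[]/eqP va; [exists b|exists a].
  - by rewrite inE (subsetP sE _ bE) /adjacent va -eqE.
  - by rewrite /f va.
  - by rewrite inE (subsetP sE _ aE) /adjacent va setUC -eqE.
  - by rewrite /f va setUC.
rewrite /degsum (eq_bigr _ deg) exchange_big /= mulnC -sum_nat_const.
apply: eq_bigr => E EG; have [sE <-] := edgesP EG.
rewrite -big_mkcondr -sum1_card /=; apply: eq_bigl => v.
by case vE: (v \in E); rewrite ?andbF // (subsetP sE).
Qed.

Lemma induced_wf A : [forall E in [set E in edges G | E \subset A], (E \subset A) && (#|E| == 2)].
Proof.
apply/forall_inP => E; rewrite inE => /andP[EG ->] /=.
by have [_ ->] := edgesP EG.
Qed.

Definition induced A := SGraph (induced_wf A).

Lemma induced_proper A : A \subset V -> A != V -> proper_subgraph (induced A) G.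
Proof.
move=> sA neq; rewrite /proper_subgraph /subgraph /= sA neq /= andbT.
by apply/subsetP => E; rewrite inE => /andP[].
Qed.

Lemma induced_coloring A c : proper_coloring (induced A) c -> proper_on e A c.
Proof.
move=> pc x y xA yA exy; apply: pc; rewrite /adjacent inE /= subUset !sub1set xA yA.
by rewrite !andbT.
Qed.

Variable k : nat.
Hypothesis Gcrit : list_critical k G.
Hypothesis Gncomplete : ~~ complete G.

(** [L] consists of what a bad assignment of [G] leaves on [F] after [V :\: F] has been colored;
    criticality permits this as [F] is nonempty. *)
Lemma critical_uncolorable F : F \subset V -> F != set0 -> exists2 L,
  {in F, forall v, k.-1 + degin e F v <= #|` L v| + degin e V v} & ~ colorable e F L.
Proof.
move=> FV F0; have [nch chH] := Gcrit.
have [L0 HL0] : exists L0 : T -> {fset nat}, (forall x, x \in V -> k.-1 <= #|` L0 x|) /\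
    ~ colorable e V L0.
  apply: NNPP => no; apply: nch => L0 HL0; apply: NNPP => nc; apply: no.
  exists L0; split=> // -[c pc cL]; apply: nc; exists c; split=> // x y exy.
  by have [xV yV] := adjacent_vertices exy; apply: pc.
have [szL0 ncV] := HL0.
have neq : V :\: F != V.
  have /set0Pn[x xF] := F0; apply: contraTneq xF => eqV.
  by have := subsetP FV x; rewrite -eqV inE; case: (x \in F) => // /(_ isT).
have [c [pc cL]] : exists c, proper_coloring (induced (V :\: F)) c /\
    (forall x, x \in V :\: F -> c x \in L0 x).
  apply: (chH _ (induced_proper (subsetDl _ _) neq)) => x /setDP[xV _].
  exact: szL0.
exists (avail e (V :\: F) c L0) => [v vF|col].
  rewrite (degin_setID e v FV); have := card_avail e (V :\: F) c L0 v.
  by have := szL0 v (subsetP FV v vF); clear; lia.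
apply: ncV; apply: (colorable_extend adjacent_sym (Q := V :\: F) (c := c)) => //.
- exact: subsetDl.
- exact: induced_coloring.
by rewrite setDDr setDv set0U (setIidPr FV).
Qed.

(** As [G] is not complete, a clique spans a proper subgraph. Giving all vertices the same [k - 1]
    colors, criticality provides a coloring that is injective on the clique. *)
Lemma critical_clique D : D \subset V -> clique e D -> #|D| <= k.-1.
Proof.
move=> sD clD; have neq : D != V.
  apply: contra Gncomplete => /eqP eqD; apply/forall_inP => x xV.
  by apply/forall_inP => y yV; apply/implyP; apply: (cliqueP _ _ clD); rewrite eqD.
have [_ /(_ _ (induced_proper sD neq)) chD] := Gcrit.
have [x _|c [pc cL]] := chD (fun=> [fset i | i in iota 0 k.-1]%fset).
  by rewrite card_fseq undup_id ?iota_uniq // size_iota.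
have pD := induced_coloring pc.
have cinj : {in D &, injective c}.
  move=> x y xD yD eqc; apply/eqP/negPn/negP => neqxy.
  by have := pD x y xD yD (cliqueP _ _ clD x y xD yD neqxy); rewrite eqc eqxx.
rewrite -[X in _ <= X](size_iota 0) cardE -(size_map c).
apply: uniq_leq_size => [|_ /mapP[x xD ->]].
  by rewrite map_inj_in_uniq ?enum_uniq // => x y; rewrite !mem_enum; apply: cinj.
by rewrite mem_enum in xD; have := cL x xD; rewrite !inE.
Qed.

Lemma critical_average_degree (x : rat) : (6 <= k)%N -> (x = k%:R ->
  x - 1 + (2 * x - 5) * (x - 3) / (x ^+ 3 - 12 * x + 15) <= average_degree G)%R.
Proof.
move=> k6 xE.
(* The graph without vertices counts as complete. *)
have V0 : (0 < #|V|)%N.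
  rewrite lt0n; apply: contra Gncomplete => /eqP/cards0_eq V0.
  by apply/forall_inP => y; rewrite V0 inE.
have m5 : 4 < k.-1 by move: k6; clear; lia.
have mE : ((k.-1)%:R = x - 1 :> rat)%R.
  by rewrite xE -subn1 natrB // (leq_trans _ k6).
rewrite /average_degree ler_pdivlMr ?ltr0n // -degsum_edges -mE.
apply: (degree_sum_bound adjacent_sym adjacent_irr m5 critical_uncolorable critical_clique).
by rewrite mE; ring.
Qed.

End CriticalSgraph.

(** * Comparison with the stated bounds *)

Local Open Scope ring_scope.

(** As polynomials in [y = x - 7], both denominators and the difference of the cross products have
    nonnegative coefficients. *)
Lemma bound_compare (x : rat) : 7 <= x ->
  (x - 3) ^+ 2 * (2 * x - 3) / (x ^+ 4 - 2 * x ^+ 3 - 11 * x ^+ 2 + 28 * x - 14)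
  <= (2 * x - 5) * (x - 3) / (x ^+ 3 - 12 * x + 15).
Proof.
move=> x7; pose y := x - 7; have y0 : 0 <= y by rewrite subr_ge0.
have xE : x = y + 7 by rewrite /y; ring.
have y2 : 0 <= y ^+ 2 by rewrite exprn_ge0.
have y3 : 0 <= y ^+ 3 by rewrite exprn_ge0.
have y4 : 0 <= y ^+ 4 by rewrite exprn_ge0.
have D1 : 0 < x ^+ 4 - 2 * x ^+ 3 - 11 * x ^+ 2 + 28 * x - 14 by rewrite xE; lra.
have D2 : 0 < x ^+ 3 - 12 * x + 15 by rewrite xE; lra.
rewrite ler_pdivrMr // [X in _ <= X]mulrAC ler_pdivlMr // -subr_ge0.
rewrite (_ : _ - _ = (x - 3) * (3 * y ^+ 3 + 36 * y ^+ 2 + 138 * y + 166)); last first.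
  by rewrite xE; ring.
by rewrite mulr_ge0 //; lra.
Qed.

Theorem mainTheorem1 (T : finType) (G : sgraph T) (k : nat)
    (Gcrit : list_critical k G) (Gncomplete : ~~ complete G) :
  ((7 <= k)%N ->
     average_degree G >=
       k%:R - 1 +
       (k%:R - 3) ^+ 2 * (2 * k%:R - 3) /
       (k%:R ^+ 4 - 2 * k%:R ^+ 3 - 11 * k%:R ^+ 2 + 28 * k%:R - 14)) /\
  (k = 6%N -> average_degree G >= 5 + 93 / 766).
Proof.
have bound x k6 := @critical_average_degree T G k Gcrit Gncomplete x k6.
split=> [k7|k6].
  apply: le_trans (bound _ (ltnW k7) erefl); rewrite lerD2l; apply: bound_compare.
  by rewrite (ler_nat _ 7).
have {bound} : 6 - 1 + (2 * 6 - 5) * (6 - 3) / (6 ^+ 3 - 12 * 6 + 15) <= average_degree G.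
  by apply: bound; rewrite k6.
apply: le_trans.
(* For [k = 6] the bound is [5 + 21 / 159], which exceeds [5 + 93 / 766]. *)
have -> : 6 ^+ 3 - 12 * 6 + 15 = 159 :> rat by ring.
lra.
Qed.
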